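(* Let $A$ be a unital $C^*$-algebra with unity $I$. Then: (i) $A\widehat\otimes_r A$ is $*$-semisimple if and only if $A=\mathbb C I$. (ii) $A\widehat\otimes_r A$ is symmetric if and only if $A=\mathbb C I$.
   Context: Operator space projective tensor product: for operator spaces $V,W$ and $u\in V\otimes W$, $\|u\|_\wedge=\inf\{\|\alpha\|\|v\|\|w\|\|\beta\|: u=\alpha(v\otimes w)\beta\}$ over $p,q\in\mathbb N$, $\alpha\in \mathbb M_{1,pq}$, $\beta\in\mathbb M_{pq,1}$, $v\in M_p(V)$, $w\in M_q(W)$, where $v\otimes w=(v_{ij}\otimes w_{kl})_{(i,k),(j,l)}\in M_{pq}(V\otimes W)$; $V\widehat\otimes W$ is the completion of $V\otimes W$ in $\|\cdot\|_\wedge$. For a $C^*$-algebra $A$, $A\widehat\otimes A$ is a Banach algebra with the usual multiplication. The reverse involution is determined by $(a\otimes b)^*=b^*\otimes a^*$ for $a,b\in A$; it extends to an isometric involution on $A\widehat\otimes A$, and $A\widehat\otimes_r A$ denotes the Banach $*$-algebra $A\widehat\otimes A$ with this involution. A Banach $*$-algebra $X$ is $*$-semisimple if its $*$-radical, the intersection of the kernels of all (irreducible) $*$-representations of $X$ on Hilbert spaces, is $\{0\}$. $X$ is symmetric if $-x^*x$ is quasi-regular for every $x\in X$ (for unital $X$: $1+x^*x$ is invertible for every $x\in X$). *)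

(* Defs.v *)
From HB Require Import structures.
From mathcomp Require Import all_boot all_order all_algebra.
From mathcomp Require Import sesquilinear.
From mathcomp Require Import all_classical all_reals all_analysis.
From mathcomp Require Import complex mxtens.

Set Implicit Arguments.
Unset Strict Implicit.
Unset Printing Implicit Defensive.

Import Order.TTheory GRing.Theory Num.Theory.
Import numFieldNormedType.Exports.

Local Open Scope classical_set_scope.
Local Open Scope complex_scope.
Local Open Scope ring_scope.
Local Open Scope quotient_scope.

(** * Algebraic tensor product

   Elements of V (x) W are formal sums of pairs, identified when they have the
   same image under every bilinear map; scalars act on the left factor. *)

Section AlgebraicTensor.
Context {K : fieldType} {V W : lmodType K}.

Definition tens_eval (U : lmodType K) (b : {bilinear V -> W -> U})
  (s : seq (V * W)) : U := \sum_(x <- s) b x.1 x.2.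

Definition tens_eq (s t : seq (V * W)) : Prop :=
  forall (U : lmodType K) (b : {bilinear V -> W -> U}),
    tens_eval b s = tens_eval b t.

Definition tens_eqb (s t : seq (V * W)) : bool := `[< tens_eq s t >].

Lemma tens_eqb_refl : reflexive tens_eqb.
Proof. by move=> s; apply/asboolP. Qed.

Lemma tens_eqb_sym : symmetric tens_eqb.
Proof. by move=> s t; apply/asboolP/asboolP => h U b; rewrite h. Qed.

Lemma tens_eqb_trans : transitive tens_eqb.
Proof.
move=> s t u /asboolP h1 /asboolP h2; apply/asboolP => U b.
by rewrite h1 h2.
Qed.

Canonical tens_equiv := EquivRel tens_eqb
  tens_eqb_refl tens_eqb_sym tens_eqb_trans.

Definition tensor := {eq_quot tens_equiv}.
HB.instance Definition _ := Choice.on tensor.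
HB.instance Definition _ := EqQuotient.on tensor.

Definition tens_scale_seq (c : K) (s : seq (V * W)) : seq (V * W) :=
  [seq (c *: x.1, x.2) | x <- s].

Definition tens_zero : tensor := \pi_tensor [::].
Definition tens_add (x y : tensor) : tensor := \pi_tensor (repr x ++ repr y).
Definition tens_scale (c : K) (x : tensor) : tensor :=
  \pi_tensor (tens_scale_seq c (repr x)).
Definition tens_opp (x : tensor) : tensor := tens_scale (-1) x.

Definition tens (v : V) (w : W) : tensor := \pi_tensor [:: (v, w)].

(* the linear map on V (x) W induced by a bilinear map *)
Definition tens_lift (U : lmodType K) (b : {bilinear V -> W -> U})
  (x : tensor) : U := tens_eval b (repr x).

Lemma tens_lift_pi U b s : @tens_lift U b (\pi_tensor s) = tens_eval b s.
Proof.
by rewrite /tens_lift; have /eqmodP/asboolP -> : repr (\pi_tensor s) = s %[mod tensor]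
  by rewrite reprK.
Qed.

Lemma tensorP (x y : tensor) :
  (forall (U : lmodType K) (b : {bilinear V -> W -> U}), tens_lift b x = tens_lift b y) ->
  x = y.
Proof.
move=> h; rewrite -[x]reprK -[y]reprK; apply/eqmodP/asboolP => U b.
exact: h.
Qed.

Lemma tens_lift0 U b : @tens_lift U b tens_zero = 0.
Proof. by rewrite tens_lift_pi /tens_eval big_nil. Qed.

Lemma tens_liftD U b x y :
  @tens_lift U b (tens_add x y) = tens_lift b x + tens_lift b y.
Proof. by rewrite tens_lift_pi /tens_eval big_cat. Qed.

Lemma tens_liftZ U b c x :
  @tens_lift U b (tens_scale c x) = c *: tens_lift b x.
Proof.
rewrite tens_lift_pi /tens_eval big_map scaler_sumr.
by apply: eq_bigr => z _; rewrite linearZl_LR.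
Qed.

Lemma tens_liftE U b v w : @tens_lift U b (tens v w) = b v w.
Proof. by rewrite tens_lift_pi /tens_eval big_seq1. Qed.

Lemma tens_addA : associative tens_add.
Proof. by move=> x y z; apply: tensorP => U b; rewrite !tens_liftD addrA. Qed.

Lemma tens_addC : commutative tens_add.
Proof. by move=> x y; apply: tensorP => U b; rewrite !tens_liftD addrC. Qed.

Lemma tens_add0 : left_id tens_zero tens_add.
Proof.
by move=> x; apply: tensorP => U b; rewrite tens_liftD tens_lift0 add0r.
Qed.

Lemma tens_addN : left_inverse tens_zero tens_opp tens_add.
Proof.
move=> x; apply: tensorP => U b.
by rewrite tens_liftD tens_liftZ tens_lift0 scaleN1r addNr.
Qed.

HB.instance Definition _ :=
  GRing.isZmodule.Build tensor tens_addA tens_addC tens_add0 tens_addN.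

Lemma tens_scaleA c d (x : tensor) :
  tens_scale c (tens_scale d x) = tens_scale (c * d) x.
Proof. by apply: tensorP => U b; rewrite !tens_liftZ scalerA. Qed.

Lemma tens_scale1 : left_id 1 tens_scale.
Proof. by move=> x; apply: tensorP => U b; rewrite tens_liftZ scale1r. Qed.

Lemma tens_scaleDr : right_distributive tens_scale (@GRing.add tensor).
Proof.
move=> c x y; apply: tensorP => U b.
by rewrite tens_liftZ !tens_liftD !tens_liftZ scalerDr.
Qed.

Lemma tens_scaleDl (x : tensor) : {morph tens_scale^~ x : c d / c + d}.
Proof.
move=> c d; apply: tensorP => U b.
by rewrite tens_liftZ tens_liftD !tens_liftZ scalerDl.
Qed.

HB.instance Definition _ := GRing.Zmodule_isLmodule.Build K tensor
  tens_scaleA tens_scale1 tens_scaleDr tens_scaleDl.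

Lemma tens_lift_is_linear (U : lmodType K) (b : {bilinear V -> W -> U}) :
  linear (@tens_lift U b : tensor -> U).
Proof. by move=> c x y; rewrite tens_liftD tens_liftZ. Qed.

Lemma tensDl v v' w : tens (v + v') w = tens v w + tens v' w.
Proof.
by apply: tensorP => U b; rewrite tens_liftD !tens_liftE linearDl.
Qed.

Lemma tensDr v w w' : tens v (w + w') = tens v w + tens v w'.
Proof.
by apply: tensorP => U b; rewrite tens_liftD !tens_liftE linearDr.
Qed.

Lemma tensZl c v w : tens (c *: v) w = c *: tens v w.
Proof.
by apply: tensorP => U b; rewrite tens_liftZ !tens_liftE linearZl_LR.
Qed.

Lemma tensZr c v w : tens v (c *: w) = c *: tens v w.
Proof.
by apply: tensorP => U b; rewrite tens_liftZ !tens_liftE linearZr_LR.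
Qed.

Lemma tensor_sum (x : tensor) : x = \sum_(z <- repr x) tens z.1 z.2.
Proof.
apply: tensorP => U b; rewrite {1}/tens_lift /tens_eval.
elim: (repr x) => [|z s ih]; first by rewrite !big_nil tens_lift0.
by rewrite !big_cons tens_liftD tens_liftE ih.
Qed.

End AlgebraicTensor.

Arguments tensor {K} V W.
Notation "V (x) W" := (tensor V W) (at level 40, left associativity) : type_scope.

(** * Banach *-algebras and C*-algebras (complex and unital)

   The norm is a real-valued function on an [algType R[i]]: there is no room in
   the library hierarchy for a common extension of non-commutative algebras and
   [completeNormedModType]. *)

Definition norm_complete (R : realType) (V : zmodType) (N : V -> R) : Prop :=
  forall x_ : nat -> V,
    (forall e, 0 < e -> exists m, forall i j,
       (m <= i)%N -> (m <= j)%N -> N (x_ i - x_ j) < e) ->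
    exists l, forall e, 0 < e -> exists m, forall i,
       (m <= i)%N -> N (x_ i - l) < e.

HB.mixin Record isBanachAlgebra (R : realType) X of GRing.Algebra R[i] X := {
  bnorm : X -> R ;
  bnormD : forall x y, bnorm (x + y) <= bnorm x + bnorm y ;
  bnormZ : forall (c : R[i]) x, bnorm (c *: x) = Normc.normc c * bnorm x ;
  bnorm_eq0 : forall x, bnorm x = 0 -> x = 0 ;
  bnormM : forall x y, bnorm (x * y) <= bnorm x * bnorm y ;
  bnorm_complete : norm_complete bnorm
}.

#[short(type="banachAlgType")]
HB.structure Definition BanachAlgebra (R : realType) :=
  { X of GRing.Algebra R[i] X & isBanachAlgebra R X }.

HB.mixin Record isBanachStarAlgebra (R : realType) X of BanachAlgebra R X := {
  star : X -> X ;
  starK : involutive star ;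
  starD : {morph star : x y / x + y} ;
  starZ : forall (c : R[i]) x, star (c *: x) = conjc c *: star x ;
  starM : forall x y, star (x * y) = star y * star x ;
  star_bnorm : forall x, bnorm (star x) = bnorm x
}.

#[short(type="banachStarAlgType")]
HB.structure Definition BanachStarAlgebra (R : realType) :=
  { X of BanachAlgebra R X & isBanachStarAlgebra R X }.

HB.mixin Record isCstarAlgebra (R : realType) A of BanachStarAlgebra R A := {
  cstar_identity : forall a : A, bnorm (star a * a) = bnorm a ^+ 2
}.

#[short(type="cstarAlgType")]
HB.structure Definition CstarAlgebra (R : realType) :=
  { A of BanachStarAlgebra R A & isCstarAlgebra R A }.

(** * The operator space structure of a C*-algebra

   Matrix norms on a complex vector space V are families of functions
   [forall n, 'M[V]_n -> R].  Note that ['M[A]_n] is an [A]-module in the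
   library, so complex scalars act through [mx_cscale]. *)

Definition mx_cscale (R : realType) (V : lmodType R[i]) m n (c : R[i])
  (x : 'M[V]_(m, n)) : 'M[V]_(m, n) := map_mx ( *:%R c) x.

Definition mx_star (R : realType) (A : banachStarAlgType R) n (x : 'M[A]_n) :
  'M[A]_n := map_mx star (x^T).

(* [N] makes the *-algebra M_n(A) a C*-algebra *)
Record is_cstar_norm (R : realType) (A : cstarAlgType R) n
    (N : 'M[A]_n -> R) : Prop := {
  cnormD : forall x y, N (x + y) <= N x + N y ;
  cnormZ : forall c x, N (mx_cscale c x) = Normc.normc c * N x ;
  cnorm_eq0 : forall x, N x = 0 -> x = 0 ;
  cnormM : forall x y, N (x *m y) <= N x * N y ;
  cnorm_star : forall x, N (mx_star x *m x) = N x ^+ 2 ;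
  cnorm_complete : norm_complete N
}.

(* The norms of the C*-algebras M_n(A), n in nat: the canonical operator space
   structure of A.  Each of them exists and is unique. *)
Definition cstar_matrix_norms (R : realType) (A : cstarAlgType R)
    (N : forall n, 'M[A]_n -> R) : Prop :=
  forall n, is_cstar_norm (N n).

(** * The operator space projective tensor norm *)

Section ProjectiveNorm.
Context {R : realType} {V W : lmodType R[i]}.

(* v (x) w, row and column indices being the pairs (i, k) and (j, l) *)
Definition mx_tensor p q (v : 'M[V]_p) (w : 'M[W]_q) : 'M[V (x) W]_(p * q) :=
  \matrix_(s, t) tens (v (mxtens_unindex s).1 (mxtens_unindex t).1)
                      (w (mxtens_unindex s).2 (mxtens_unindex t).2).

(* alpha x beta, for scalar matrices alpha and beta *)
Definition mx_bracket n (alpha : 'M[R[i]]_(1, n)) (x : 'M[V (x) W]_n)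
    (beta : 'M[R[i]]_(n, 1)) : V (x) W :=
  \sum_s \sum_t (alpha 0 s * beta t 0) *: x s t.

(* the operator norms of M_{1,n}(C) and M_{n,1}(C) are Euclidean norms *)
Definition row_norm n (alpha : 'M[R[i]]_(1, n)) : R :=
  Num.sqrt (\sum_s Normc.normc (alpha 0 s) ^+ 2).
Definition col_norm n (beta : 'M[R[i]]_(n, 1)) : R :=
  Num.sqrt (\sum_t Normc.normc (beta t 0) ^+ 2).

Definition proj_norm (NV : forall n, 'M[V]_n -> R)
    (NW : forall n, 'M[W]_n -> R) (u : V (x) W) : R :=
  inf [set r | exists p q (alpha : 'M[R[i]]_(1, p * q))
        (v : 'M[V]_p) (w : 'M[W]_q) (beta : 'M[R[i]]_(p * q, 1)),
      [/\ (0 < p)%N, (0 < q)%N, u = mx_bracket alpha (mx_tensor v w) beta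
        & r = row_norm alpha * NV p v * NW q w * col_norm beta]].

End ProjectiveNorm.

(** * The Banach *-algebra given by the reverse involution

   [rev_proj_tensor N iota] says that the Banach *-algebra X, with
   [iota : A (x) A -> X], is the completion of A (x) A for the projective norm,
   with the usual product and the reverse involution.  Since the range of iota
   is dense, this determines X up to isometric *-isomorphism. *)

Record rev_proj_tensor (R : realType) (A : cstarAlgType R)
    (N : forall n, 'M[A]_n -> R) (X : banachStarAlgType R)
    (iota : {linear A (x) A -> X}) : Prop := {
  rpt_isometry : forall u, bnorm (iota u) = proj_norm N N u ;
  rpt_dense : forall x e, 0 < e -> exists u, bnorm (x - iota u) < e ;
  rpt_mul : forall a b c d : A,
    iota (tens a b) * iota (tens c d) = iota (tens (a * c) (b * d)) ;
  rpt_star : forall a b : A,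
    star (iota (tens a b)) = iota (tens (star b) (star a))
}.

(** * Hilbert spaces, *-representations, *-semisimplicity, symmetry *)

HB.mixin Record isHilbert (R : realType) H of CompleteNormedModule R[i] H := {
  hdot : {dot H for @conjc R} ;
  hdotE : forall x : H, hdot x x = `|x| ^+ 2
}.

#[short(type="hilbertType")]
HB.structure Definition Hilbert (R : realType) :=
  { H of CompleteNormedModule R[i] H & isHilbert R H }.

Record star_representation (R : realType) (X : banachStarAlgType R)
    (H : hilbertType R) (rho : X -> {linear H -> H}) : Prop := {
  rep_bounded : forall x, continuous (rho x) ;
  repD : forall x y h, rho (x + y) h = rho x h + rho y h ;
  repZ : forall (c : R[i]) x h, rho (c *: x) h = c *: rho x h ;
  repM : forall x y h, rho (x * y) h = rho x (rho y h) ;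
  rep_star : forall x h k, hdot (rho x h) k = hdot h (rho (star x) k)
}.

Definition star_radical (R : realType) (X : banachStarAlgType R) : set X :=
  [set x | forall (H : hilbertType R) (rho : X -> {linear H -> H}),
     star_representation rho -> forall h, rho x h = 0].

Definition star_semisimple (R : realType) (X : banachStarAlgType R) : Prop :=
  @star_radical R X = [set 0].

Definition invertible (X : pzRingType) (x : X) : Prop :=
  exists y, y * x = 1 /\ x * y = 1.

Definition star_symmetric (R : realType) (X : banachStarAlgType R) : Prop :=
  forall x : X, invertible (1 + star x * x).

(* Main.v *)
Require Import Defs.
From HB Require Import structures.
From mathcomp Require Import all_boot all_order all_algebra.
From mathcomp Require Import all_classical all_reals all_analysis.
From mathcomp Require Import complex.
From mathcomp Require Import sesquilinear mxtens ring lra.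

(** The reverse involution satisfies (a (x) 1)^* = 1 (x) a for self-adjoint a.
   In a *-representation rho, for u unitary, the images of u (x) 1 and u^* (x) 1
   are mutually inverse contractions, so rho (u (x) 1) is unitary and
   rho (1 (x) u^* ) = rho (u (x) 1)^* = rho (u^* (x) 1).  Unitaries span A, so
   a (x) 1 - 1 (x) a is in the *-radical for every a.

   If A is not C, some self-adjoint a has both 1 and -1 as approximate
   eigenvalues: (a - 1) y and (a + 1) z are small relative to y and z.  As
   |y (x) z| = |y| |z|, then (a (x) 1 - 1 (x) a) (y (x) z) ~ 2 (y (x) z) is not
   zero, so X is not *-semisimple; and
   (1 + a (x) a) (y (x) z) ~ y (x) z - y (x) z = 0 shows that 1 + x^* x, where
   x = a (x) 1, is not invertible, so X is not symmetric.

   Functional calculus is replaced by two elementary facts: 1 - x has a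
   self-adjoint square root when x is self-adjoint of norm < 1, and
   |z|^2 <= |z^2 + w^2| for commuting self-adjoint z, w in a C*-algebra. *)

Set Implicit Arguments.
Unset Strict Implicit.
Unset Printing Implicit Defensive.

Import Order.TTheory GRing.Theory Num.Theory.
Import numFieldNormedType.Exports.
Local Open Scope classical_set_scope.
Local Open Scope complex_scope.
Local Open Scope ring_scope.

(** * Square roots in Banach *-algebras *)

Section ComplexModulus.
Context {R : realType}.
Implicit Types (c : R[i]) (t : R).

Lemma normcR t : Normc.normc t%:C = `|t|.
Proof. by rewrite /= expr0n addr0 sqrtr_sqr. Qed.

Lemma normc_ge0 c : 0 <= Normc.normc c.
Proof. by case: c => a b; exact: sqrtr_ge0. Qed.

Lemma normc_conj c : Normc.normc (conjc c) = Normc.normc c.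
Proof. by case: c => a b /=; rewrite sqrrN. Qed.

End ComplexModulus.

(** The norm is a parameter, not [bnorm], because a second complete norm on the same algebra, read
    off from corner matrices, will be compared with [bnorm]. *)
Record banach_star_norm (R : realType) (X : banachStarAlgType R) (q : X -> R)
    : Prop := {
  bsnD : forall x y, q (x + y) <= q x + q y ;
  bsnZ : forall c x, q (c *: x) = Normc.normc c * q x ;
  bsn_eq0 : forall x, q x = 0 -> x = 0 ;
  bsnM : forall x y, q (x * y) <= q x * q y ;
  bsn_star : forall x, q (star x) = q x ;
  bsn_complete : norm_complete q
}.

Lemma bnorm_bsn (R : realType) (X : banachStarAlgType R) :
  banach_star_norm (bnorm : X -> R).
Proof.
split; [exact: bnormD | exact: bnormZ | exact: bnorm_eq0 | exact: bnormM
  | exact: star_bnorm | exact: bnorm_complete].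
Qed.

Section StarAlgebra.
Context {R : realType} {X : banachStarAlgType R}.
Implicit Types (x y z : X).

Lemma star1 : star 1 = 1 :> X.
Proof. by rewrite -[RHS]starK -[star 1]mul1r starM starK mul1r. Qed.

Lemma star0 : star 0 = 0 :> X.
Proof. by apply: (addIr (star 0)); rewrite -starD !add0r. Qed.

Lemma starN x : star (- x) = - star x.
Proof. by apply/eqP; rewrite -addr_eq0 -starD addNr star0. Qed.

Lemma starB x y : star (x - y) = star x - star y.
Proof. by rewrite starD starN. Qed.

Lemma starZR (t : R) x : star (t%:C *: x) = t%:C *: star x.
Proof. by rewrite starZ conjc_real. Qed.

End StarAlgebra.

Section BanachStarNorm.
Context {R : realType} {X : banachStarAlgType R} {q : X -> R}.
Hypothesis hq : banach_star_norm q.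
Implicit Types (x y z : X).

Lemma bsn0 : q 0 = 0.
Proof. by rewrite -(scale0r (0 : X)) (bsnZ hq) Normc.normc0 mul0r. Qed.

Lemma bsnN x : q (- x) = q x.
Proof. by rewrite -scaleN1r (bsnZ hq) normcN Normc.normc1 mul1r. Qed.

Lemma bsnZR (t : R) x : q (t%:C *: x) = `|t| * q x.
Proof. by rewrite (bsnZ hq) normcR. Qed.

Lemma bsn_ge0 x : 0 <= q x.
Proof.
have := bsnD hq x (- x); rewrite subrr bsn0 bsnN; lra.
Qed.

Lemma bsnB x y : q (x - y) <= q x + q y.
Proof. by rewrite -(bsnN y) (bsnD hq). Qed.

Lemma bsnC x y : q (x - y) = q (y - x).
Proof. by rewrite -bsnN opprB. Qed.

Lemma bsn_tri z x y : q (x - y) <= q (x - z) + q (z - y).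
Proof. by have := bsnD hq (x - z) (z - y); rewrite addrA subrK. Qed.

Lemma bsn_small x (K : R) : (forall e, 0 < e -> q x <= K * e) -> x = 0.
Proof.
move=> h; apply: (bsn_eq0 hq); apply/eqP; rewrite eq_le bsn_ge0 andbT.
rewrite leNgt; apply/negP => q0.
have K0 : 0 < `|K| + 1 by rewrite ltr_wpDl.
have e0 : 0 < q x / 2 / (`|K| + 1) by rewrite !divr_gt0.
have := h _ e0; rewrite leNgt => /negP; apply.
rewrite mulrA mulrAC.
have : K / (`|K| + 1) <= 1.
  by rewrite ler_pdivrMr // mul1r (le_trans (ler_norm K)) // lerDl.
rewrite mulrA mulrAC; set d := K / _; set a := q x in q0 *; nra.
Qed.

Section Sqrt.
Variable x : X.
Hypotheses (x_sa : star x = x) (x_lt1 : q x < 1).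

Let f w : X := (2^-1)%:C *: (x + w * w).
Let w_ n := iter n f 0.

Let q_f w : q w <= q x -> q (f w) <= q x.
Proof.
move=> hw; rewrite /f bsnZR ger0_norm ?invr_ge0 //.
have := le_trans (bsnD hq x (w * w)) (lerD (lexx _) (bsnM hq w w)).
have := bsn_ge0 w; have w1 : q w < 1 by apply: le_lt_trans x_lt1.
by nra.
Qed.

Let q_fB w v : q w <= q x -> q v <= q x -> q (f w - f v) <= q x * q (w - v).
Proof.
move=> hw hv.
(* w^2 - v^2 = w (w - v) + (w - v) v holds without commutativity. *)
have -> : f w - f v = (2^-1)%:C *: (w * (w - v) + (w - v) * v).
  rewrite /f -scalerBr; congr (_ *: _).
  by rewrite mulrBr mulrBl addrA subrK opprD addrACA subrr add0r.
rewrite bsnZR ger0_norm ?invr_ge0 //.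
have := bsnD hq (w * (w - v)) ((w - v) * v).
have := bsnM hq w (w - v); have := bsnM hq (w - v) v.
have d0 := bsn_ge0 (w - v).
have := ler_wpM2r d0 hw; have := ler_wpM2r d0 hv; lra.
Qed.

Let q_w n : q (w_ n) <= q x.
Proof. by elim: n => [|n ih]; rewrite ?bsn0 ?bsn_ge0 //; exact: q_f. Qed.

Let q_wB n m : q (w_ (n + m)%N - w_ n) <= q x ^+ n.
Proof.
elim: n m => [|n ih] m.
  by rewrite /= subr0 expr0 (le_trans (q_w _)) // ltW.
rewrite addSn /= exprS (le_trans (q_fB _ _)) ?q_w //.
by rewrite ler_wpM2l ?bsn_ge0.
Qed.

Let q_pow e : 0 < e -> exists n, q x ^+ n < e.
Proof.
move=> e0.
have /cvgrPdist_lt /(_ _ e0) [n _ /(_ n (leqnn n))] :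
    (fun n => q x ^+ n) @ \oo --> (0 : R).
  by apply: cvg_expr; rewrite ger0_norm ?bsn_ge0.
by rewrite sub0r normrN ger0_norm ?exprn_ge0 ?bsn_ge0 // => h; exists n.
Qed.

Let w_lim : exists l, forall e, 0 < e -> exists m, forall i,
  (m <= i)%N -> q (w_ i - l) < e.
Proof.
apply: (bsn_complete hq) => e e0.
have [n hn] : exists n, q x ^+ n < e / 2 by apply: q_pow; rewrite divr_gt0.
exists n => i j ni nj.
have hw k : (n <= k)%N -> q (w_ k - w_ n) < e / 2.
  by move=> nk; rewrite -(subnKC nk) (le_lt_trans (q_wB _ _)).
rewrite (le_lt_trans (bsn_tri (w_ n) _ _)) // [ltRHS]splitr.
by rewrite ltrD // ?hw // bsnC hw.
Qed.

(* The iteration w |-> (x + w^2) / 2 is a contraction of the ball of radius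
   q x, and its fixed point w satisfies (1 - w)^2 = 1 - x. *)
Lemma sa_sqrt : exists y, [/\ star y = y, y * y = 1 - x
  & forall z, z * x = x * z -> z * y = y * z].
Proof.
have [l hl] := w_lim.
have near e : 0 < e -> exists n, q (w_ n - l) < e /\ q (w_ n.+1 - l) < e.
  by move=> /hl[m hm]; exists m; rewrite !hm.
have l_sa : star l = l.
  apply/eqP; rewrite -subr_eq0; apply/eqP/(@bsn_small _ 2) => e /near[n [hn _]].
  have sw : star (w_ n) = w_ n.
    elim: {hn} n => [|n ih]; rewrite /= ?star0 // /f starZR starD starM.
    by rewrite -/(w_ n) ih x_sa.
  have := bsn_tri (w_ n) (star l) l.
  rewrite -{1}sw -starB (bsn_star hq) [q (l - _)]bsnC.
  lra.
have l_comm z : z * x = x * z -> z * l = l * z.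
  move=> zx; apply/eqP; rewrite -subr_eq0; apply/eqP.
  apply: (@bsn_small _ (2 * q z)) => e /near[n [hn _]].
  have zw : z * w_ n = w_ n * z.
    elim: {hn} n => [|n ih]; rewrite /= ?mulr0 ?mul0r // /f.
    rewrite -scalerAl -scalerAr mulrDr mulrDl zx mulrA -/(w_ n) ih.
    by rewrite -mulrA ih mulrA.
  have -> : z * l - l * z = z * (l - w_ n) - (l - w_ n) * z.
    by rewrite mulrBr mulrBl zw opprB addrA subrK.
  have := bsnB (z * (l - w_ n)) ((l - w_ n) * z).
  have := bsnM hq z (l - w_ n); have := bsnM hq (l - w_ n) z.
  have := bsn_ge0 z; rewrite [q (l - _)]bsnC; nra.
have l_fix : f l = l.
  apply/eqP; rewrite -subr_eq0; apply/eqP/(@bsn_small _ 2) => e e0.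
  have ql : q l <= q x.
    apply/ler_addgt0Pr => d /near[n [hn _]].
    have := bsnB (w_ n) (w_ n - l); rewrite opprB addrC subrK.
    by have := q_w n; lra.
  have [n [hn hn1]] := near e e0.
  have := bsn_tri (w_ n.+1) (f l) l; have := q_fB ql (q_w n).
  rewrite /= -/(w_ n) in hn1 *; rewrite [q (l - _)]bsnC.
  have := ler_wpM2r (bsn_ge0 (w_ n - l)) (ltW x_lt1); lra.
exists (1 - l); split.
- by rewrite starB star1 l_sa.
- have xE : x = l + l - l * l.
    have <- : 2%:C *: l = l + l by rewrite rmorphMn rmorph1 scaler_nat mulr2n.
    rewrite -{1}l_fix /f scalerA -rmorphM /= divff // rmorph1 scale1r.
    by rewrite addrK.
  by rewrite mulrBr mulr1 mulrBl mul1r xE !opprD !opprK !addrA.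
- by move=> z /l_comm h; rewrite mulrBr mulrBl mul1r mulr1 h.
Qed.

End Sqrt.
End BanachStarNorm.

(** * C*-norms *)

Record cstar_norm (R : realType) (A : banachStarAlgType R) (p : A -> R)
    : Prop := {
  cstar_norm_bsn :> banach_star_norm p ;
  cstar_normE : forall a, p (star a * a) = p a ^+ 2
}.

Lemma bnorm_cstar (R : realType) (A : cstarAlgType R) :
  cstar_norm (bnorm : A -> R).
Proof. by split; [exact: bnorm_bsn | exact: cstar_identity]. Qed.

Section CstarNorm.
Context {R : realType} {A : banachStarAlgType R} {p : A -> R}.
Hypothesis hp : cstar_norm p.
Implicit Types (a b c z w : A).

Lemma cstar_norm_sa a : star a = a -> p (a * a) = p a ^+ 2.
Proof. by move=> ha; rewrite -{1}ha (cstar_normE hp). Qed.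

Lemma cstar_norm1 : p 1 = 1.
Proof.
have := cstar_norm_sa star1; rewrite mulr1 expr2 => /eqP.
have p1 : p 1 != 0.
  by apply/eqP => /(bsn_eq0 hp) /eqP; rewrite oner_eq0.
by rewrite -{1}[p 1]mulr1 (inj_eq (mulfI p1)) eq_sym => /eqP.
Qed.

(* z is the real part of z + iw, whose norm is that of z^2 + w^2. *)
Lemma cstar_norm_sqD z w : star z = z -> star w = w -> z * w = w * z ->
  p z ^+ 2 <= p (z * z + w * w).
Proof.
move=> hz hw zw; pose u : A := z + 'i *: w.
have su : star u = z - 'i *: w.
  by rewrite /u starD starZ hz hw -scaleNr; congr (_ + _ *: _); simpc.
have -> : z * z + w * w = star u * u.
  rewrite su /u mulrBl !mulrDr -!scalerAl -!scalerAr zw scalerA.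
  by rewrite -['i * 'i]expr2 sqr_i opprD addrA addrK scaleN1r opprK.
rewrite (cstar_normE hp) ler_sqr ?nnegrE ?bsn_ge0 //; try exact: hp.
have : z + z = u + star u by rewrite su /u addrACA subrr addr0.
move/(congr1 p); have := bsnD hp u (star u); rewrite (bsn_star hp).
have -> : p (z + z) = 2 * p z.
  have := bsnZR hp 2 z; rewrite rmorphMn rmorph1 scaler_nat mulr2n => ->.
  by rewrite ger0_norm.
lra.
Qed.

(* AM-GM: (z (1 + c^2))^2 = (2 z c)^2 + (z (1 - c^2))^2. *)
Lemma cstar_norm_amgm z c : star z = z -> star c = c -> z * c = c * z ->
  2 * p (z * c) <= p (z * (1 + c * c)).
Proof.
move=> hz hc zc.
pose g := z * c * c; pose v := z * c + z * c.
have zg : z * g = z * c * (z * c).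
  by rewrite /g -!mulrA; congr (z * _); rewrite mulrA [RHS]mulrA zc.
have gz : g * z = z * c * (z * c) by rewrite /g -mulrA -zc.
have hg : star g = g by rewrite /g !starM hz hc -zc mulrA -zc.
have hzc : star (z * c) = z * c by rewrite starM hz hc zc.
have ch : c * (z * c) = z * c * c by rewrite mulrA zc.
have cg : z * c * g = g * (z * c) by rewrite /g -[in RHS]mulrA ch.
have cz : z * c * z = z * (z * c) by rewrite -mulrA zc.
have uE : z * (1 + c * c) = z + g by rewrite mulrDr mulr1 mulrA.
have sv : star v = v by rewrite /v starD hzc.
have sw : star (z - g) = z - g by rewrite starB hz hg.
have vw : v * (z - g) = (z - g) * v.
  by rewrite /v [LHS]mulrDl [RHS]mulrDr !mulrBr !mulrBl cg cz.
have := cstar_norm_sqD sv sw vw.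
have -> : v * v + (z - g) * (z - g) = (z + g) * (z + g).
  have -> : (z - g) * (z - g) = z * z - z * g + (g * g - g * z).
    by rewrite mulrBl !mulrBr opprB.
  have -> : v * v = (z * g + z * g) + (g * z + g * z).
    by rewrite /v mulrDl !mulrDr zg gz.
  rewrite gz -zg addrACA mulrDl !mulrDr [g * z]gz -zg.
  have hlp (h k : A) : h + h + (k - h) = k + h by rewrite addrC addrA subrK.
  by rewrite !hlp [g * g + _]addrC.
have -> : (z + g) * (z + g) = star (z + g) * (z + g) by rewrite starD hz hg.
rewrite (cstar_normE hp) ler_sqr ?nnegrE ?bsn_ge0 //; try exact: hp.
rewrite uE; apply: le_trans.
have := bsnZR hp 2 (z * c); rewrite rmorphMn rmorph1 scaler_nat mulr2n.
by rewrite ger0_norm // => ->.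
Qed.

End CstarNorm.

(* If q a < 1 then 1 - (a^* a)^2 is a square y^2 with y commuting with a^* a,
   and 1 = (a^* a)^2 + y^2 dominates (a^* a)^2 in any C*-norm. *)
Lemma cstar_norm_le (R : realType) (A : banachStarAlgType R) (p q : A -> R) :
  cstar_norm p -> banach_star_norm q -> forall a, p a <= q a.
Proof.
move=> hp hq; have unit_ball a : q a < 1 -> p a <= 1.
  move=> qa; pose x := star a * a.
  have sx : star x = x by rewrite /x starM starK.
  have q_lt1 (u v : A) : q u < 1 -> q v < 1 -> q (u * v) < 1.
    move=> u1 v1; apply: le_lt_trans (bsnM hq u v) _.
    by have := bsn_ge0 hq u; have := bsn_ge0 hq v; nra.
  have qx : q x < 1 by rewrite q_lt1 // (bsn_star hq).
  have sxx : star (x * x) = x * x by rewrite starM sx.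
  have [y [sy yy yC]] := sa_sqrt hq sxx (q_lt1 _ _ qx qx).
  have := cstar_norm_sqD hp sx sy (yC x (mulrA _ _ _)).
  rewrite yy addrC subrK (cstar_norm1 hp) (cstar_normE hp).
  by rewrite -exprM expr_le1 // bsn_ge0 //; exact: hp.
move=> a; rewrite leNgt; apply/negP => qp.
(* Dividing by the midpoint of q a < p a puts a inside the open unit ball of q but outside the
   closed unit ball of p. *)
pose t := (q a + p a) / 2.
have t0 : 0 < t by have := bsn_ge0 hq a; rewrite /t; lra.
have tV : `|t^-1| = t^-1 by rewrite ger0_norm // invr_ge0 ltW.
have := unit_ball (t^-1%:C *: a); rewrite (bsnZR hq) (bsnZR hp) tV.
rewrite ![t^-1 * _]mulrC ltr_pdivrMr // ler_pdivrMr // !mul1r.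
by rewrite /t => h; have := h ltac:(lra); lra.
Qed.

(** Both norms are complete, so the comparison holds in both directions. *)
Lemma cstar_norm_unique (R : realType) (A : banachStarAlgType R)
    (p q : A -> R) : cstar_norm p -> cstar_norm q -> p =1 q.
Proof.
move=> hp hq a; apply/eqP; rewrite eq_le !cstar_norm_le //.
  exact: (cstar_norm_bsn hp).
exact: (cstar_norm_bsn hq).
Qed.

(** * Approximate eigenvalues of self-adjoint elements *)

Section ApproximateEigenvalues.
Context {R : realType} {A : cstarAlgType R}.
Implicit Types (a b y : A) (lambda mu s t : R).

Local Notation bsn := (@bnorm_bsn R A).
Local Notation cstar := (@bnorm_cstar R A).

(** The strict inequality forces [y] to be nonzero. The vectors are elements of A, on which [a] acts
    by left multiplication. *)
Definition approx_eigen a lambda := forall e, 0 < e -> exists y : A,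
  bnorm (a * y - lambda%:C *: y) < e * bnorm y.

Lemma approx_eigen_affine a lambda s t :
  approx_eigen a lambda -> approx_eigen (s%:C *: a + t%:C%:A) (s * lambda + t).
Proof.
(* Adding 1 keeps the divisor positive when s = 0. *)
move=> ha e e0; have s0 : 0 < `|s| + 1 by rewrite ltr_wpDl.
have [y hy] := ha (e / (`|s| + 1)) (divr_gt0 e0 s0); exists y.
have -> : (s%:C *: a + t%:C%:A) * y - (s * lambda + t)%:C *: y =
    s%:C *: (a * y - lambda%:C *: y).
  rewrite mulrDl -!scalerAl mul1r rmorphD rmorphM scalerDl opprD addrACA subrr.
  by rewrite addr0 scalerBr scalerA.
rewrite (bsnZR bsn); move: hy; rewrite mulrAC ltr_pdivlMr // mulrC.
by apply: le_lt_trans; rewrite mulrDl mul1r lerDl bsn_ge0 //; exact: bsn.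
Qed.

Lemma star_exp b n : star b = b -> star (b ^+ n) = b ^+ n.
Proof.
move=> sb; elim: n => [|n ih]; rewrite ?star1 //.
by rewrite exprSr starM ih sb -exprS exprSr.
Qed.

(** Repeated squaring gives norm 1 at the exponents 2^m; b^n is a factor of b^(2^n), whose norm
    would drop below 1 if that of b^n did. *)
Lemma bnorm_sa_exp b n : star b = b -> bnorm b = 1 -> bnorm (b ^+ n) = 1.
Proof.
move=> sb b1.
have X2 m : bnorm (b ^+ (2 ^ m)) = 1.
  elim: m => [|m ih] //; rewrite expnS mul2n -addnn exprD.
  by rewrite (cstar_norm_sa cstar) ?star_exp // ih expr1n.
have X_le1 k : bnorm (b ^+ k) <= 1.
  elim: k => [|k ih]; first by rewrite (cstar_norm1 cstar).
  by rewrite exprS (le_trans (bsnM bsn _ _)) // b1 mul1r.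
apply/eqP; rewrite eq_le X_le1 /= -(X2 n).
have nn : (n <= 2 ^ n)%N by rewrite ltnW // ltn_expl.
rewrite -{1}(subnK nn) exprD (le_trans (bsnM bsn _ _)) //.
by rewrite ler_piMl // bsn_ge0 //; exact: bsn.
Qed.

(* The geometric sum of the powers of b^2 of exponent < 2^m. *)
Fixpoint geom b m : A :=
  if m is m'.+1 then geom b m' * (1 + b ^+ (2 ^ m') * b ^+ (2 ^ m')) else 1.

Lemma geom_comm b m k : b ^+ k * geom b m = geom b m * b ^+ k.
Proof.
elim: m => [|m ih] /=; first by rewrite mulr1 mul1r.
rewrite mulrA ih -!mulrA; congr (_ * _).
by rewrite mulrDr mulrDl mulr1 mul1r -!exprD addnC.
Qed.

(** Telescoping: with c = b^(2^m), (1 - c^2) (1 + c^2) = 1 - c^4. *)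
Lemma geomE b m : (1 - b * b) * geom b m = 1 - b ^+ (2 ^ m) * b ^+ (2 ^ m).
Proof.
elim: m => [|m ih] /=; first by rewrite mulr1.
rewrite mulrA ih mulrDr mulr1 mulrBl mul1r addrA subrK.
by rewrite -!exprD !addnn -!mul2n !expnS !mulnA.
Qed.

(** The induction treats b^k geom b m for all k at once: with c = b^(2^m), [cstar_norm_amgm] bounds
    the norm of b^k geom b m (1 + c^2) below by twice that of b^(k + 2^m) geom b m. *)
Lemma geom_ge b m : star b = b -> bnorm b = 1 -> 2 ^+ m <= bnorm (geom b m).
Proof.
move=> sb b1.
have sX k := star_exp k sb.
have sgeom k : star (geom b k) = geom b k.
  elim: k => [|k ih] /=; first exact: star1.
  rewrite starM starD starM star1 ih sX mulrDl mulrDr mul1r mulr1.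
  by rewrite -!exprD geom_comm.
have h k : 2 ^+ m <= bnorm (b ^+ k * geom b m).
  elim: m k => [|m ih] k; first by rewrite mulr1 bnorm_sa_exp.
  rewrite exprS /= mulrA.
  have := ih (k + 2 ^ m)%N; rewrite exprD -mulrA geom_comm mulrA.
  set z := b ^+ k * geom b m; set c := b ^+ (2 ^ m) => hm.
  have zc : z * c = c * z.
    by rewrite /z -mulrA -geom_comm !mulrA -!exprD addnC.
  have sz : star z = z by rewrite /z starM sgeom sX geom_comm.
  have := cstar_norm_amgm cstar sz (sX _) zc; apply: le_trans.
  by rewrite ler_pM2l.
by have := h 0%N; rewrite mul1r.
Qed.

(** If -1 fails, b + 1 is bounded below by some d > 0. Then (b + 1) geom b m has norm at least d
    2^m, while b - 1 maps it to b^(2^(m+1)) - 1, of norm at most 2. *)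
Lemma approx_eigen_unit b : star b = b -> bnorm b = 1 ->
  approx_eigen b 1 \/ approx_eigen b (-1).
Proof.
move=> sb b1.
have [hN|/existsNP[d /not_implyP[d0 /forallNP hd]]] :=
  pselect (approx_eigen b (-1)); [by right|left => e e0].
have {}hd y : d * bnorm y <= bnorm (b * y + y).
  by have /negP := hd y; rewrite -leNgt rmorphN rmorph1 scaleN1r opprK.
have [m hm] : exists m, 2 < e * d * 2 ^+ m :> R.
  have [m hm] : exists m : nat, 2 / (e * d) < m%:R
    by exists (Num.truncn (2 / (e * d))).+1; rewrite truncnS_gt.
  exists m; rewrite mulrC -ltr_pdivrMr ?mulr_gt0 // (lt_trans hm) //.
  by rewrite -natrX ltr_nat ltn_expl.
exists (b * geom b m + geom b m).
have -> : b * (b * geom b m + geom b m) - 1%:C *: (b * geom b m + geom b m)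
    = - (1 - b ^+ (2 ^ m) * b ^+ (2 ^ m)).
  rewrite rmorph1 scale1r -geomE mulrBl mul1r -mulrA mulrDr opprB.
  by rewrite opprD addrA addrK.
rewrite (bsnN bsn); apply: (@le_lt_trans _ _ 2).
  rewrite (le_trans (bsnB bsn _ _)) // (cstar_norm1 cstar) -exprD.
  by rewrite bnorm_sa_exp.
rewrite (lt_le_trans hm) // -mulrA ler_pM2l //.
by apply: le_trans (hd _); rewrite ler_pM2l // geom_ge.
Qed.

Lemma approx_eigen_sa b : star b = b -> b != 0 ->
  exists2 mu, mu != 0 & approx_eigen b mu.
Proof.
move=> sb b0; pose t := bnorm b.
have t0 : 0 < t.
  rewrite lt_neqAle (bsn_ge0 bsn) andbT eq_sym.
  by apply: contra_neq b0 => /(bsn_eq0 bsn).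
have bE (mu : R) : approx_eigen (t^-1%:C *: b) mu -> approx_eigen b (t * mu).
  move=> /(@approx_eigen_affine _ _ t 0).
  rewrite scalerA -rmorphM divff ?gt_eqF // rmorph1 scale1r.
  by rewrite rmorph0 scale0r !addr0.
have : approx_eigen (t^-1%:C *: b) 1 \/ approx_eigen (t^-1%:C *: b) (-1).
  apply: approx_eigen_unit; first by rewrite starZR sb.
  by rewrite (bsnZR bsn) ger0_norm ?invr_ge0 ?ltW // mulVf // gt_eqF.
case=> /bE h; [exists (t * 1)|exists (t * -1)] => //; rewrite ?mulrN mulr1.
  by rewrite gt_eqF.
by rewrite oppr_eq0 gt_eqF.
Qed.

(** Otherwise a + star a and i (a - star a), being self-adjoint, would be scalar for every a, and a
    is a combination of them. *)
Lemma nonscalar_sa : ~ (forall a : A, exists c : R[i], a = c%:A) ->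
  exists2 a : A, star a = a & forall c : R[i], a != c%:A.
Proof.
move=> h; apply: contrapT => hsa; apply: h => a.
have sc b : star b = b -> exists c : R[i], b = c%:A.
  move=> sb; apply: contrapT => hb; apply: hsa; exists b => // c.
  by apply/eqP => bc; apply: hb; exists c.
have [|c hc] := sc (a + star a); first by rewrite starD starK addrC.
have [|d hd] := sc ('i *: (a - star a)).
  by rewrite starZ starB starK -opprB scalerN -scaleNr; congr (_ *: _); simpc.
exists (2^-1 * (c - 'i * d)).
have -> : a = 2^-1 *: ((a + star a) + (a - star a)).
  rewrite addrACA subrr addr0 -[a + a]mulr2n -[a *+ 2]scaler_nat scalerA.
  by rewrite mulVf ?scale1r.
have -> : a - star a = (- 'i * d)%:A.
  by rewrite -scalerA -hd scalerA mulNr -expr2 sqr_i opprK scale1r.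
by rewrite hc -scalerDl scalerA mulNr.
Qed.

(* Subtracting an approximate eigenvalue from a non-scalar element leaves a
   nonzero one, which has an approximate eigenvalue of maximal modulus. *)
Lemma approx_eigen_pm1 : ~ (forall a : A, exists c : R[i], a = c%:A) ->
  exists a : A, [/\ star a = a, approx_eigen a 1 & approx_eigen a (-1)].
Proof.
move=> /nonscalar_sa[a sa ha].
have [lambda hl] : exists lambda, approx_eigen a lambda.
  have [|mu _ ?] := approx_eigen_sa sa; last by exists mu.
  by have := ha 0; rewrite scale0r.
pose b := a - lambda%:C%:A.
have bE : b = 1%:C *: a + (- lambda)%:C%:A.
  by rewrite rmorph1 scale1r rmorphN scaleNr.
have sb : star b = b by rewrite starB sa starZR star1.
have b0 : b != 0 by rewrite subr_eq0.
have [mu mu0 hmu] := approx_eigen_sa sb b0.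
(* The map x |-> (2 / mu) x - 1 sends mu to 1 and 0 to -1. *)
exists ((2 / mu)%:C *: b + (-1)%:C%:A); split.
- by rewrite starD !starZR star1 sb.
- have := approx_eigen_affine (2 / mu) (-1) hmu.
  by rewrite divfK // (_ : 2 + -1 = 1) //; lra.
- have := approx_eigen_affine 1 (- lambda) hl; rewrite -bE mul1r subrr.
  by move/(approx_eigen_affine (2 / mu) (-1)); rewrite mulr0 add0r.
Qed.

End ApproximateEigenvalues.

(** * The Hahn-Banach theorem *)

Section HahnBanach.
Context {R : realType} {V : lmodType R[i]}.
Implicit Types (s p : V -> R) (x y : V) (t : R).

(** Homogeneity is asked as an inequality, the form in which it passes to infima; equality follows
    on applying it to 1/t. *)
Definition sublinear s :=
  (forall x y, s (x + y) <= s x + s y) /\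
  (forall t x, 0 < t -> s (t%:C *: x) <= t * s x).

Lemma sublinear0 s : sublinear s -> s 0 = 0.
Proof.
move=> [_ sZ]; have := sZ 2 0 ltac:(by []); have := sZ 2^-1 0 ltac:(by []).
by rewrite !scaler0; lra.
Qed.

Lemma sublinearZ s t x : sublinear s -> 0 <= t -> s (t%:C *: x) = t * s x.
Proof.
move=> hs; rewrite le_eqVlt => /predU1P[<-|t0].
  by rewrite rmorph0 scale0r mul0r sublinear0.
apply/eqP; rewrite eq_le hs.2 //= -ler_pdivlMl //.
have tV : 0 < t^-1 by rewrite invr_gt0.
have := hs.2 _ (t%:C *: x) tV.
by rewrite scalerA -rmorphM mulVf ?gt_eqF // rmorph1 scale1r.
Qed.

Lemma sublinear_opp_ge s x : sublinear s -> - s (- x) <= s x.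
Proof.
by move=> hs; have := hs.1 x (- x); rewrite subrr (sublinear0 hs); lra.
Qed.

(** This serves infima along a ray and infima of chains. The index [k] is the sum of two parameters
    on a ray, and the smaller of two functionals in a chain. *)
Lemma inf_sublinear (I : Type) (i0 : I) (F : I -> V -> R) :
  (forall x, exists b, forall i, b <= F i x) ->
  (forall i j x y, exists k, F k (x + y) <= F i x + F j y) ->
  (forall i t x, 0 < t -> exists k, F k (t%:C *: x) <= t * F i x) ->
  exists s, [/\ sublinear s, forall i x, s x <= F i x
    & forall x b, (forall i, b <= F i x) -> b <= s x].
Proof.
move=> lbF FD FZ; pose E x : set R := range (F^~ x).
have E0 x : E x !=set0 by exists (F i0 x), i0.
have infE i x : inf (E x) <= F i x.
  apply: ge_inf; last by exists i.
  by have [b hb] := lbF x; exists b => _ [j _ <-].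
have leinf x b : (forall i, b <= F i x) -> b <= inf (E x).
  by move=> hb; apply: lb_le_inf => // _ [i _ <-].
exists (fun x => inf (E x)); split=> //; split=> [x y|t x t0].
  rewrite -lerBlDr; apply: (leinf) => i; rewrite lerBlDr -lerBlDl.
  apply: (leinf) => j; rewrite lerBlDl.
  by have [k hk] := FD i j x y; exact: le_trans hk.
rewrite -ler_pdivrMl //; apply: leinf => i; rewrite ler_pdivrMl //.
by have [k hk] := FZ i t x t0; exact: le_trans hk.
Qed.

(** s' x is the infimum over t >= 0 of s (x + t y) - t s y; t = 0 and t = 1 give the two bounds.
    Writing [|t|] lets the index range over all of R. *)
Lemma ray_sublinear s y : sublinear s -> exists s', [/\ sublinear s',
  forall x, s' x <= s x & forall x, s' x <= s (x + y) - s y].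
Proof.
move=> hs.
have [|||s' [hs' les _]] :=
    @inf_sublinear R 0 (fun t x => s (x + `|t|%:C *: y) - `|t| * s y).
- move=> x; exists (- s (- x)) => t; rewrite -(sublinearZ y hs) //.
  have := hs.1 (x + `|t|%:C *: y) (- x); rewrite addrAC subrr add0r; lra.
- move=> t u x x'; exists (`|t| + `|u|).
  have := hs.1 (x + `|t|%:C *: y) (x' + `|u|%:C *: y).
  rewrite addrACA -scalerDl -rmorphD [`|_ + _|]ger0_norm ?addr_ge0 //; lra.
- move=> t u x u0; exists (u * t).
  rewrite normrM gtr0_norm // rmorphM -scalerA -scalerDr mulrBr mulrA lerB //.
  exact: hs.2.
exists s'; split=> // x.
  by have := les 0 x; rewrite normr0 rmorph0 scale0r addr0 mul0r subr0.
by have := les 1 x; rewrite normr1 rmorph1 scale1r mul1r.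
Qed.

(** Zorn's lemma for the reversed pointwise order: a nonempty chain is bounded by its pointwise
    infimum, which is finite because s x >= - p (- x). *)
Lemma minimal_sublinear p : sublinear p -> exists s, [/\ sublinear s,
  forall x, s x <= p x &
  forall s', sublinear s' -> (forall x, s' x <= s x) -> forall x, s x <= s' x].
Proof.
move=> hp; pose T := {s : V -> R | sublinear s /\ forall x, s x <= p x}.
pose le (s s' : T) := `[< forall x, sval s' x <= sval s x >].
have p0 : T by exists p.
have [|||m hm] := @ZL_preorder T p0 le.
- by move=> s; apply/asboolP.
- move=> r s u /asboolP rs /asboolP su; apply/asboolP => x.
  exact: le_trans (su x) (rs x).
- move=> C totC; have [[c Cc]|C0] := pselect (C !=set0); last first.
    by exists p0 => s Cs; case: C0; exists s.
  pose I := {s : T | C s}.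
  have [|||s [hs les _]] :=
      @inf_sublinear I (exist _ c Cc) (fun i => sval (sval i)).
  + move=> x; exists (- p (- x)) => -[[s [hs sp]] Cs] /=.
    by apply: le_trans (sublinear_opp_ge x hs); rewrite lerN2.
  + move=> [i Ci] [j Cj] x y /=.
    have [/asboolP ij|/asboolP ji] := totC _ _ Ci Cj.
      exists (exist _ j Cj) => /=; apply: le_trans ((svalP j).1.1 x y) _.
      by rewrite lerD2r.
    exists (exist _ i Ci) => /=; apply: le_trans ((svalP i).1.1 x y) _.
    by rewrite lerD2l.
  + by move=> [i Ci] t x t0; exists (exist _ i Ci) => /=; exact: (svalP i).1.2.
  have sp x : s x <= p x.
    by apply: le_trans (les (exist _ c Cc) x) _; exact: (svalP c).2.
  exists (exist _ s (conj hs sp)) => d Cd; apply/asboolP => x /=.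
  exact: (les (exist _ d Cd)).
exists (sval m); have [hs sp] := svalP m; split=> // s' hs' s's x.
have s'p y : s' y <= p y by apply: le_trans (sp y).
have /(_ ltac:(exact/asboolP))/asboolP := hm (exist _ s' (conj hs' s'p)).
exact.
Qed.

(** By minimality s lies below the functional of [ray_sublinear], hence s x <= s (x + y) - s y. *)
Lemma minimal_additive s : sublinear s ->
  (forall s', sublinear s' -> (forall x, s' x <= s x) ->
    forall x, s x <= s' x) ->
  forall x y, s (x + y) = s x + s y.
Proof.
move=> hs hmin x y; apply/eqP; rewrite eq_le hs.1 /=.
have [s' [hs' les les']] := ray_sublinear y hs.
by have := hmin s' hs' les x; have := les' x; lra.
Qed.

(* A minimal sublinear functional is real-linear, and its complexification is
   x |-> s x - i s (i x). *)
Lemma hahn_banach_norming p (x0 : V) :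
  (forall x y, p (x + y) <= p x + p y) ->
  (forall c x, p (c *: x) = Normc.normc c * p x) ->
  exists f : {scalar V}, (forall x, Normc.normc (f x) <= p x) /\
    Normc.normc (f x0) = p x0.
Proof.
move=> pD pZ.
have hp : sublinear p.
  by split=> // t x t0; rewrite pZ normcR gtr0_norm.
(* Starting below the ray functional gives s (- x0) <= p 0 - p x0 = - p x0, which makes s attain p
   at x0. *)
have [p' [hp' lep lep']] := ray_sublinear x0 hp.
have [s [hs les hmin]] := minimal_sublinear hp'.
have sD := minimal_additive hs hmin.
have sN x : s (- x) = - s x.
  by apply/eqP; rewrite -addr_eq0 addrC -sD subrr sublinear0.
have sZ t x : s (t%:C *: x) = t * s x.
  have [t0|/ltW t0] := leP 0 t; first exact: sublinearZ.
  rewrite -[t]opprK rmorphN scaleNr sN sublinearZ ?oppr_ge0 //.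
  by rewrite !mulNr.
have sx0 : p x0 <= s x0.
  have := les (- x0); have := lep' (- x0).
  by rewrite addNr (sublinear0 hp) sN; lra.
pose f x : R[i] := s x -i* s ('i *: x).
have sii x : s ('i *: ('i *: x)) = - s x.
  by rewrite scalerA -expr2 sqr_i scaleN1r sN.
have scZ (c : R[i]) x :
    s (c *: x) = complex.Re c * s x + complex.Im c * s ('i *: x).
  by rewrite {1}[c]complexE ['i * _]mulrC scalerDl sD -scalerA !sZ.
have fP : scalar f.
  move=> c x y; rewrite /f scalerDr !sD scalerA [_ * c]mulrC -scalerA.
  rewrite !(scZ c) sii.
  by case: c => a b /=; simpc; congr Complex; ring.
pose F := HB.pack_for {scalar V} f (GRing.isLinear.Build _ _ _ _ f fP).
have fZ c x : f (c *: x) = c * f x := linearZ_LR F c x.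
have p_ge0 x : 0 <= p x.
  have := pD x (- x); rewrite subrr -scaleN1r pZ normcN Normc.normc1 mul1r.
  by rewrite (sublinear0 hp); lra.
have lef x : Normc.normc (f x) <= p x.
  have [->|f0] := eqVneq (f x) 0; first by rewrite Normc.normc0.
  have n0 : 0 < Normc.normc (f x).
    rewrite lt_neqAle normc_ge0 andbT eq_sym; apply: contra_neq f0.
    exact: Normc.eq0_normc.
  (* Multiplying x by the conjugate of f x makes the value real, equal to |f x|^2. *)
  have : complex.Re (f (conjc (f x) *: x)) <= Normc.normc (f x) * p x.
    rewrite -normc_conj -pZ; exact: le_trans (les _) (lep _).
  rewrite fZ -[X in _ -> is_true X](ler_pM2l n0); apply: le_trans.
  rewrite -expr2 le_eqVlt; apply/orP; left; apply/eqP.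
  case: (f x) => a b /=; rewrite sqr_sqrtr ?addr_ge0 ?sqr_ge0 //; ring.
exists F; split=> //; apply/eqP; rewrite eq_le lef /=.
apply: le_trans sx0 _; apply: le_trans (ler_norm _) _.
by rewrite -sqrtr_sqr /= ler_wsqrtr // lerDl sqr_ge0.
Qed.

End HahnBanach.

(** * Matrix norms and the cross norm property *)

Section MatrixNorms.
Context {R : realType} {A : cstarAlgType R} {N : forall n, 'M[A]_n -> R}.
Hypothesis hN : cstar_matrix_norms N.

Section FixedSize.
Context {n : nat}.
Implicit Types (x y : 'M[A]_n).

Lemma mx_starK : involutive (@mx_star R A n).
Proof. by move=> x; apply/matrixP => i j; rewrite !mxE starK. Qed.

Lemma mx_norm0 : N (0 : 'M[A]_n) = 0.
Proof.
have -> : 0 = mx_cscale 0 (0 : 'M[A]_n).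
  by apply/matrixP => i j; rewrite !mxE scale0r.
by rewrite (cnormZ (hN n)) Normc.normc0 mul0r.
Qed.

Lemma mx_normN x : N (- x) = N x.
Proof.
have -> : - x = mx_cscale (-1) x.
  by apply/matrixP => i j; rewrite !mxE scaleN1r.
by rewrite (cnormZ (hN n)) normcN Normc.normc1 mul1r.
Qed.

Lemma mx_norm_ge0 x : 0 <= N x.
Proof.
by have := cnormD (hN n) x (- x); rewrite subrr mx_norm0 mx_normN; lra.
Qed.

(** N y ^ 2 = N (star y y) <= N (star y) N y, applied to x and to its adjoint. *)
Lemma mx_norm_star x : N (mx_star x) = N x.
Proof.
have le y : N y <= N (mx_star y).
  have [->|y0] := eqVneq (N y) 0; first exact: mx_norm_ge0.
  have Ny : 0 < N y by rewrite lt_neqAle mx_norm_ge0 andbT eq_sym.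
  rewrite -(ler_pM2r Ny) -expr2 -(cnorm_star (hN n)).
  exact: (cnormM (hN n)).
apply/eqP; rewrite eq_le le andbT.
by have := le (mx_star x); rewrite mx_starK.
Qed.

End FixedSize.

Section Corner.
Context {n : nat}.
Implicit Types (a b : A) (eta xi : 'I_n.+1 -> R[i]).

Definition mx_corner a : 'M[A]_n.+1 :=
  \matrix_(i, j) (if (i == 0) && (j == 0) then a else 0).

(** A scalar column padded with zeros, since the norms [N n] live on square matrices only. *)
Definition mx_first_col eta : 'M[A]_n.+1 :=
  \matrix_(i, j) (if j == 0 then (eta i)%:A else 0).

Lemma sum_ord0 (F : 'I_n.+1 -> A) : (forall i, i != 0 -> F i = 0) ->
  \sum_i F i = F 0.
Proof. by move=> h; rewrite (bigD1 0) //= big1 ?addr0. Qed.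

Lemma mx_cornerM a b : mx_corner (a * b) = mx_corner a *m mx_corner b.
Proof.
apply/matrixP => i j; rewrite !mxE sum_ord0 => [|k /negPf k0]; rewrite !mxE.
  by rewrite eqxx andbT /=; do 2?case: eqP; rewrite ?mul0r ?mulr0.
by rewrite k0 andbF mul0r.
Qed.

Lemma mx_cornerD a b : mx_corner (a + b) = mx_corner a + mx_corner b.
Proof. by apply/matrixP => i j; rewrite !mxE; case: ifP; rewrite ?addr0. Qed.

Lemma mx_cornerB a b : mx_corner (a - b) = mx_corner a - mx_corner b.
Proof. by apply/matrixP => i j; rewrite !mxE; case: ifP; rewrite ?subr0. Qed.

Lemma mx_cornerZ (c : R[i]) a : mx_corner (c *: a) = mx_cscale c (mx_corner a).
Proof. by apply/matrixP => i j; rewrite !mxE; case: ifP; rewrite ?scaler0. Qed.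

Lemma mx_corner_star a : mx_corner (star a) = mx_star (mx_corner a).
Proof.
by apply/matrixP => i j; rewrite !mxE andbC; case: ifP; rewrite ?star0.
Qed.

Lemma mx_corner_compress (x : 'M[A]_n.+1) :
  mx_corner 1 *m x *m mx_corner 1 = mx_corner (x 0 0).
Proof.
apply/matrixP => i j; rewrite !mxE sum_ord0 => [|k /negPf k0]; rewrite !mxE.
  rewrite sum_ord0 => [|k /negPf k0]; rewrite !mxE ?k0 ?andbF ?mul0r //.
  rewrite !eqxx andbT /=.
  by case: (i == 0); case: (j == 0); rewrite ?mul1r ?mulr1 ?mul0r ?mulr0.
by rewrite k0 mulr0.
Qed.

(** The corner embedding is a *-homomorphism, so it pulls [N] back to a complete C*-norm on A, and
    such a norm is unique. *)
Lemma mx_norm_corner a : N (mx_corner a) = bnorm a.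
Proof.
suff h : cstar_norm (fun a : A => N (mx_corner a)).
  exact: (cstar_norm_unique h (@bnorm_cstar _ A)).
have N1 : N (mx_corner 1) <= 1.
  have := cnorm_star (hN n.+1) (mx_corner 1).
  rewrite -mx_corner_star -mx_cornerM star1 mulr1.
  by have := mx_norm_ge0 (mx_corner 1); nra.
split; last first.
  by move=> b; rewrite -(cnorm_star (hN n.+1)) -mx_corner_star mx_cornerM.
split.
- by move=> b c; rewrite mx_cornerD; exact: (cnormD (hN n.+1)).
- by move=> c b; rewrite mx_cornerZ (cnormZ (hN n.+1)).
- move=> b /(cnorm_eq0 (hN n.+1)) /matrixP /(_ 0 0).
  by rewrite !mxE eqxx.
- by move=> b c; rewrite mx_cornerM; exact: (cnormM (hN n.+1)).
- by move=> b; rewrite mx_corner_star mx_norm_star.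
- move=> x_ hx.
  have [e /hx[m hm]|l hl] :=
      cnorm_complete (hN n.+1) (x_ := fun i => mx_corner (x_ i)).
    by exists m => i j mi mj; rewrite -mx_cornerB hm.
  (* Compressing by the corner unit, of norm at most 1, replaces l by the corner of its (0, 0) entry
     without increasing the distance. *)
  exists (l 0 0) => e /hl[m hm]; exists m => i mi.
  apply: le_lt_trans (hm i mi); rewrite mx_cornerB.
  have -> : mx_corner (x_ i) - mx_corner (l 0 0) =
      mx_corner 1 *m (mx_corner (x_ i) - l) *m mx_corner 1.
    by rewrite mulmxBr mulmxBl !mx_corner_compress mxE eqxx.
  set y := _ - l; have y0 := mx_norm_ge0 y.
  have := cnormM (hN n.+1) (mx_corner 1 *m y) (mx_corner 1).
  have := cnormM (hN n.+1) (mx_corner 1) y.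
  have := mx_norm_ge0 (mx_corner 1 *m y); nra.
Qed.

Lemma mx_first_colE eta xi (x : 'M[A]_n.+1) :
  mx_star (mx_first_col xi) *m x *m mx_first_col eta =
  mx_corner (\sum_i \sum_j (conjc (xi i) * eta j) *: x i j).
Proof.
apply/matrixP => i j; rewrite !mxE.
case: (j =P 0) => [->|/eqP/negPf j0]; last first.
  rewrite andbF big1 // => k _; rewrite !mxE j0 mulr0 //.
rewrite andbT; case: (i =P 0) => [->|/eqP/negPf i0]; last first.
  rewrite big1 // => k _; rewrite !mxE big1 ?mul0r // => l _.
  by rewrite !mxE i0 star0 mul0r.
rewrite exchange_big; apply: eq_bigr => k _; rewrite !mxE mulr_suml.
apply: eq_bigr => l _; rewrite !mxE eqxx starZ star1.
by rewrite -!scalerAl mul1r -scalerAr mulr1 scalerA.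
Qed.

(** By the C*-identity the square of this norm is the norm of the corner whose entry is the sum of
    the |eta i|^2, times 1. *)
Lemma mx_norm_first_col eta :
  N (mx_first_col eta) = Num.sqrt (\sum_i Normc.normc (eta i) ^+ 2).
Proof.
rewrite -[LHS]ger0_norm ?mx_norm_ge0 // -sqrtr_sqr; congr Num.sqrt.
rewrite -(cnorm_star (hN n.+1)) -[mx_star _]mulmx1 mx_first_colE mx_norm_corner.
have -> : \sum_i \sum_j (conjc (eta i) * eta j) *: (1%:M : 'M[A]_n.+1) i j =
    (\sum_i Normc.normc (eta i) ^+ 2)%:C%:A.
  rewrite rmorph_sum scaler_suml; apply: eq_bigr => i _.
  rewrite (bigD1 i) //= big1 => [|j ji].
    rewrite addr0 mxE eqxx rmorphXn /= [_%:C]/(`|eta i|) sqr_normc.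
    by rewrite [conjc _ * _]mulrC.
  by rewrite mxE eq_sym (negPf ji) scaler0.
rewrite (bsnZR (@bnorm_bsn _ A)) (cstar_norm1 (@bnorm_cstar _ A)) mulr1.
by rewrite ger0_norm // sumr_ge0 // => i _; rewrite sqr_ge0.
Qed.

End Corner.

(** The sum is the corner entry of a product of three square matrices, x between two padded columns.
    Size 0 has no corner and is treated apart. *)
Lemma mx_norm_form n (xi eta : 'I_n -> R[i]) (x : 'M[A]_n) :
  bnorm (\sum_i \sum_j (xi i * eta j) *: x i j) <=
  Num.sqrt (\sum_i Normc.normc (xi i) ^+ 2) * N x *
  Num.sqrt (\sum_j Normc.normc (eta j) ^+ 2).
Proof.
case: n xi eta x => [|n] xi eta x.
  by rewrite !big_ord0 sqrtr0 mulr0 (bsn0 (@bnorm_bsn _ A)).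
have -> : \sum_i \sum_j (xi i * eta j) *: x i j =
    \sum_i \sum_j (conjc (conjc (xi i)) * eta j) *: x i j.
  by apply: eq_bigr => i _; apply: eq_bigr => j _; rewrite conjcK.
rewrite -(@mx_norm_corner n) -mx_first_colE -(mx_norm_first_col eta).
under eq_bigr do rewrite -normc_conj.
pose xic i := conjc (xi i); rewrite -(mx_norm_first_col xic).
rewrite -(mx_norm_star (mx_first_col xic)).
apply: le_trans (cnormM (hN n.+1) _ _) _.
by rewrite ler_wpM2r ?mx_norm_ge0 //; exact: (cnormM (hN n.+1)).
Qed.

End MatrixNorms.

(** * Product functionals and the projective norm of elementary tensors *)

Section ProductForm.
Context {R : realType} {V W : lmodType R[i]}.

Definition product_form (f : {scalar V}) (g : {scalar W}) (x : V) (y : W)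
  : R[i]^o := f x * g y.

Lemma product_form_bilinear f g :
  bilinear_for *:%R *:%R (product_form f g).
Proof.
split=> [y c x x'|x c y y']; rewrite /product_form.
  by rewrite linearP mulrDl -mulrA.
by rewrite linearP mulrDr mulrCA.
Qed.

HB.instance Definition _ f g := bilinear_isBilinear.Build R[i] V W R[i]^o
  *:%R *:%R (product_form f g) (product_form_bilinear f g).

End ProductForm.

Section CrossNorm.
Context {R : realType} {A : cstarAlgType R} {N : forall n, 'M[A]_n -> R}.
Hypothesis hN : cstar_matrix_norms N.
Implicit Types (f g : {scalar A}) (y z : A).

Definition l2norm n (xi : 'I_n -> R[i]) : R :=
  Num.sqrt (\sum_i Normc.normc (xi i) ^+ 2).

Lemma l2norm_sq n (xi : 'I_n -> R[i]) :
  l2norm xi ^+ 2 = \sum_i Normc.normc (xi i) ^+ 2.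
Proof. by rewrite sqr_sqrtr // sumr_ge0 // => i _; exact: sqr_ge0. Qed.

(** This is [mx_norm_form] at the identity matrix, whose norm is at most 1. *)
Lemma cauchy_schwarz n (xi eta : 'I_n -> R[i]) :
  Normc.normc (\sum_i xi i * eta i) <= l2norm xi * l2norm eta.
Proof.
have N1 : N (1%:M : 'M[A]_n) <= 1.
  have := cnorm_star (hN n) 1%:M; rewrite mulmx1.
  have -> : mx_star (1%:M : 'M[A]_n) = 1%:M.
    apply/matrixP => i j; rewrite !mxE eq_sym.
    by case: eqP; rewrite ?star1 ?star0.
  by have := mx_norm_ge0 hN (1%:M : 'M[A]_n); nra.
have := mx_norm_form hN xi eta 1%:M; rewrite -/(l2norm xi) -/(l2norm eta).
have -> : \sum_i \sum_j (xi i * eta j) *: (1%:M : 'M[A]_n) i j =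
    (\sum_i xi i * eta i)%:A.
  rewrite scaler_suml; apply: eq_bigr => i _.
  rewrite (bigD1 i) //= big1 => [|j ji]; first by rewrite addr0 mxE eqxx.
  by rewrite mxE eq_sym (negPf ji) scaler0.
rewrite bnormZ (cstar_norm1 (@bnorm_cstar _ A)) mulr1 => /le_trans; apply.
by rewrite ler_wpM2r ?sqrtr_ge0 // ler_piMr ?sqrtr_ge0.
Qed.

(** Contractive functionals are completely contractive: for zeta = f(x) eta, |zeta|^2 is the value
    of f at the form of x in conj zeta and eta, hence at most |zeta| N x |eta|. *)
Lemma functional_mx_bound f n (x : 'M[A]_n) (eta : 'I_n -> R[i]) :
  (forall a, Normc.normc (f a) <= bnorm a) ->
  \sum_i Normc.normc (\sum_j f (x i j) * eta j) ^+ 2 <=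
  N x ^+ 2 * \sum_j Normc.normc (eta j) ^+ 2.
Proof.
move=> hf; pose zeta i := \sum_j f (x i j) * eta j.
rewrite -(l2norm_sq eta) -(l2norm_sq zeta) -exprMn ler_sqr ?nnegrE
  ?sqrtr_ge0 //; last by rewrite mulr_ge0 ?sqrtr_ge0 ?mx_norm_ge0.
have [->|z0] := eqVneq (l2norm zeta) 0.
  by rewrite mulr_ge0 ?sqrtr_ge0 ?mx_norm_ge0.
have {}z0 : 0 < l2norm zeta by rewrite lt_neqAle sqrtr_ge0 eq_sym z0.
rewrite -(ler_pM2l z0) -expr2 mulrA.
have := mx_norm_form hN (fun i => conjc (zeta i)) eta x.
rewrite [X in Num.sqrt X](_ : _ = \sum_i Normc.normc (zeta i) ^+ 2); last first.
  by under eq_bigr do rewrite normc_conj.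
rewrite -/(l2norm zeta) -/(l2norm eta); apply: le_trans.
apply: le_trans (hf _); rewrite linear_sum.
have -> : \sum_i f (\sum_j (conjc (zeta i) * eta j) *: x i j) =
    (l2norm zeta ^+ 2)%:C.
  rewrite l2norm_sq rmorph_sum; apply: eq_bigr => i _.
  rewrite rmorphXn /= [(Normc.normc _)%:C]/(`|zeta i|) sqr_normc mulrC.
  rewrite linear_sum mulr_sumr; apply: eq_bigr => j _.
  by rewrite linearZ /= mulrAC mulrA.
by rewrite normcR ger0_norm ?sqr_ge0.
Qed.

Lemma sum_mxtens (S : nmodType) m n (F : 'I_(m * n) -> S) :
  \sum_s F s = \sum_i \sum_k F (mxtens_index (i, k)).
Proof.
rewrite pair_bigA (reindex (@mxtens_index m n)) /=; last first.
  exists (@mxtens_unindex m n) => s _; first exact: mxtens_indexK.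
  exact: mxtens_unindexK.
by apply: eq_bigr => -[i k].
Qed.

(** The value is alpha (f(v) (x) g(w)) beta. After Cauchy-Schwarz, f(v) is bounded for each fixed
    index k, then g(w) for each fixed j. *)
Lemma product_form_bracket f g p q (v : 'M[A]_p) (w : 'M[A]_q)
    (alpha : 'M[R[i]]_(1, p * q)) (beta : 'M[R[i]]_(p * q, 1)) :
  (forall a, Normc.normc (f a) <= bnorm a) ->
  (forall a, Normc.normc (g a) <= bnorm a) ->
  Normc.normc (tens_lift (product_form f g)
    (mx_bracket alpha (mx_tensor v w) beta)) <=
  row_norm alpha * N v * N w * col_norm beta.
Proof.
move=> hf hg.
pose b j l := beta (mxtens_index (j, l)) 0.
pose d j k := \sum_l g (w k l) * b j l.
pose c s := \sum_j f (v (mxtens_unindex s).1 j) * d j (mxtens_unindex s).2.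
have -> : tens_lift (product_form f g) (mx_bracket alpha (mx_tensor v w) beta)
    = \sum_s alpha 0 s * c s.
  pose L : A (x) A -> R[i]^o := tens_lift (product_form f g).
  pose LL := HB.pack_for {linear A (x) A -> R[i]^o} L
    (GRing.isLinear.Build _ _ _ _ L (tens_lift_is_linear (product_form f g))).
  rewrite -[tens_lift _ _]/(LL _) /mx_bracket linear_sum; apply: eq_bigr => s _.
  rewrite linear_sum sum_mxtens /c mulr_sumr; apply: eq_bigr => j _.
  rewrite /d !mulr_sumr; apply: eq_bigr => l _.
  rewrite linearZ /= mxE /L tens_liftE mxtens_indexK /= /product_form /b.
  rewrite -[_ *: _]/(_ * _); ring.
apply: le_trans (cauchy_schwarz _ _) _.
rewrite -!mulrA ler_wpM2l ?sqrtr_ge0 //.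
rewrite -ler_sqr ?nnegrE ?mulr_ge0 ?sqrtr_ge0 ?mx_norm_ge0 //.
rewrite !exprMn l2norm_sq sum_mxtens exchange_big /=.
have -> : col_norm beta ^+ 2 = \sum_j \sum_l Normc.normc (b j l) ^+ 2.
  by rewrite -[LHS]/(l2norm (fun s => beta s 0) ^+ 2) l2norm_sq sum_mxtens.
apply: (@le_trans _ _ (\sum_k N v ^+ 2 * \sum_j Normc.normc (d j k) ^+ 2)).
  apply: ler_sum => k _; have := functional_mx_bound v (d^~ k) hf.
  by apply: le_trans; apply: ler_sum => i _; rewrite /c mxtens_indexK.
rewrite -mulr_sumr ler_wpM2l ?sqr_ge0 // exchange_big mulr_sumr.
by apply: ler_sum => j _; exact: functional_mx_bound.
Qed.

Lemma tens_mem_proj_norm y z : exists p q (alpha : 'M[R[i]]_(1, p * q))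
    (v : 'M[A]_p) (w : 'M[A]_q) (beta : 'M[R[i]]_(p * q, 1)),
  [/\ (0 < p)%N, (0 < q)%N, tens y z = mx_bracket alpha (mx_tensor v w) beta
    & bnorm y * bnorm z = row_norm alpha * N v * N w * col_norm beta].
Proof.
(* With p = q = 1 the corner is the whole matrix, and [mx_norm_corner] gives its norm. *)
exists 1%N, 1%N, (const_mx 1), (mx_corner y), (mx_corner z), (const_mx 1).
have sum11 (S : nmodType) (F : 'I_(1 * 1) -> S) :
    \sum_s F s = F (mxtens_index (0, 0)).
  by rewrite sum_mxtens !big_ord1.
split=> //.
  by rewrite /mx_bracket !sum11 !mxE mxtens_indexK /= mulr1 scale1r.
rewrite !mx_norm_corner // /row_norm /col_norm !sum11 !mxE Normc.normc1 expr1n.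
by rewrite sqrtr1 mul1r mulr1.
Qed.

(** The upper bound is the factorization of [tens_mem_proj_norm]; the lower bound evaluates at y (x)
    z the product of functionals norming y and z. *)
Lemma proj_norm_tens y z : proj_norm N N (tens y z) = bnorm y * bnorm z.
Proof.
apply/eqP; rewrite eq_le; apply/andP; split.
  apply: ge_inf; last exact: tens_mem_proj_norm.
  exists 0 => _ [p [q [alpha [v [w [beta [_ _ _ ->]]]]]]].
  by rewrite !mulr_ge0 ?sqrtr_ge0 ?mx_norm_ge0.
have [f [hf fy]] := hahn_banach_norming y (@bnormD R A) (@bnormZ R A).
have [g [hg gz]] := hahn_banach_norming z (@bnormD R A) (@bnormZ R A).
apply: lb_le_inf.
  by exists (bnorm y * bnorm z); exact: tens_mem_proj_norm.
move=> _ [p [q [alpha [v [w [beta [_ _ yz ->]]]]]]].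
apply: le_trans (product_form_bracket v w alpha beta hf hg).
by rewrite -yz tens_liftE /product_form Normc.normcM fy gz.
Qed.

End CrossNorm.

(** * Representations *)

Section Representation.
Context {R : realType} {X : banachStarAlgType R} {H : hilbertType R}.
Variable rho : X -> {linear H -> H}.
Hypothesis hrho : star_representation rho.
Implicit Types (x y z : X) (h k : H).

Local Notation bsn := (@bnorm_bsn R X).

(** Norm and inner product of [H] are [R[i]]-valued; this is the squared norm as a real number. *)
Definition hsq h : R := complex.Re (hdot h h).

Lemma hsq_ge0 h : 0 <= hsq h.
Proof.
have : (0 : R[i]) <= hdot h h by rewrite hdotE exprn_ge0.
by rewrite lecE => /andP[].
Qed.

Lemma hsq_le0 h : hsq h <= 0 -> h = 0.
Proof.
rewrite /hsq => h0; apply/eqP; rewrite -normr_eq0 -sqrf_eq0 -hdotE.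
have : (0 : R[i]) <= hdot h h by rewrite hdotE exprn_ge0.
rewrite lecE => /andP[/eqP Im0 Re0]; apply/eqP/eqP; rewrite eq_complex.
by rewrite Im0 eqxx andbT eq_le h0 Re0.
Qed.

Lemma hsqZ (t : R) h : hsq (t%:C *: h) = t * (t * hsq h).
Proof.
rewrite /hsq linearZl_LR linearZr_LR /=.
by case: (hdot h h) => a b; simpc.
Qed.

Lemma Re_sub (a b : R[i]) : complex.Re (a - b) = complex.Re a - complex.Re b.
Proof. by case: a b => ? ? []. Qed.

Lemma hdot_rep x y h : hdot (rho x h) (rho y h) = hdot h (rho (star x * y) h).
Proof. by rewrite (rep_star hrho) (repM hrho). Qed.

Lemma hsq_rep x h : hsq (rho x h) = complex.Re (hdot h (rho (star x * x) h)).
Proof. by rewrite /hsq hdot_rep. Qed.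

Lemma repB x y h : rho (x - y) h = rho x h - rho y h.
Proof. by rewrite (repD hrho) -scaleN1r (repZ hrho) scaleN1r. Qed.

(* If bnorm y < 1 then 1 - y^* y = z^2 for a self-adjoint z. *)
Lemma rep_contraction y h : bnorm y <= 1 -> hsq (rho y h) <= hsq (rho 1 h).
Proof.
(* Representations may be non-unital, so the comparison is with [rho 1 h] instead of h. *)
have strict w : bnorm w < 1 -> hsq (rho w h) <= hsq (rho 1 h).
  move=> w1; have sw : star (star w * w) = star w * w by rewrite starM starK.
  have ww1 : bnorm (star w * w) < 1.
    apply: le_lt_trans (bnormM _ _) _; rewrite star_bnorm.
    by have := bsn_ge0 bsn w; nra.
  have [z [sz zz _]] := sa_sqrt bsn sw ww1.
  have := hsq_ge0 (rho z h).
  by rewrite !hsq_rep sz zz repB linearBr Re_sub subr_ge0 star1 mulr1.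
move=> y1; set a := hsq _; set b := hsq _.
have b0 : 0 <= b by exact: hsq_ge0.
rewrite leNgt; apply/negP => ba.
have a0 : 0 < a by apply: le_lt_trans ba.
(* For 0 <= b < a this t is below 1, yet t^2 a = (a + b)^2 / (4 a) > b. *)
pose t := (a + b) / (2 * a).
have ta : t * (2 * a) = a + b by rewrite divfK // mulf_neq0 // gt_eqF.
have t0 : 0 < t by rewrite divr_gt0 ?mulr_gt0 // ltr_pwDl.
have t1 : t < 1 by rewrite ltr_pdivrMr ?mulr_gt0 // mul1r; lra.
have := strict (t%:C *: y); rewrite (bsnZR bsn) gtr0_norm //.
rewrite (repZ hrho) hsqZ -/a -/b => hs; have {hs} : t * (t * a) <= b.
  by apply: hs; have := bsn_ge0 bsn y; nra.
nra.
Qed.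

(* Expanding |rho (x^* - x') h|^2, both cross terms equal |rho 1 h|^2. *)
Lemma rep_star_inverse x x' h : x * x' = 1 -> bnorm x <= 1 -> bnorm x' <= 1 ->
  rho (star x) h = rho x' h.
Proof.
move=> xx' x1 x'1; apply/eqP; rewrite -subr_eq0; apply/eqP/hsq_le0.
have := rep_contraction h x'1.
have := @rep_contraction (star x) h; rewrite star_bnorm => /(_ x1).
rewrite /hsq linearBl !linearBr /= !Re_sub.
rewrite [hdot (rho (star x) h) (rho x' h)]hdot_rep starK xx'.
rewrite [hdot (rho x' h) (rho (star x) h)]hdot_rep -starM xx' star1.
rewrite [hdot (rho 1 h) _]hdot_rep star1 mulr1; lra.
Qed.

End Representation.

(** * Elements of the *-radical *)

Section Radical.
Context {R : realType} {A : cstarAlgType R} {N : forall n, 'M[A]_n -> R}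
  {X : banachStarAlgType R} {iota : {linear A (x) A -> X}}.
Hypotheses (hN : cstar_matrix_norms N) (hX : rev_proj_tensor N iota).
Implicit Types (a b c d : A).

Lemma bnorm_iota a b : bnorm (iota (tens a b)) = bnorm a * bnorm b.
Proof. by rewrite (rpt_isometry hX) proj_norm_tens. Qed.

(** The image of 1 (x) 1 is a left unit on the range of [iota], which comes arbitrarily close to
    1. *)
Lemma iota1 : iota (tens 1 1) = 1.
Proof.
set e := iota _.
have eu u : e * iota u = iota u.
  rewrite [u]tensor_sum !linear_sum mulr_sumr; apply: eq_bigr => z _.
  by rewrite (rpt_mul hX) !mul1r.
suff : e * 1 - 1 = 0 by move/eqP; rewrite subr_eq0 mulr1 => /eqP.
apply: (@bsn_small _ _ _ (bnorm_bsn X) _ (bnorm e + 1)) => r r0.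
have [u hu] := rpt_dense hX 1 r0.
have -> : e * 1 - 1 = e * (1 - iota u) - (1 - iota u).
  by rewrite mulrBr eu opprB addrA subrK.
apply: le_trans (bsnB (bnorm_bsn X) _ _) _.
have := bnormM e (1 - iota u); have := bsn_ge0 (bnorm_bsn X) e; nra.
Qed.

(** a is the real part of the unitary u = a + i s, where s^2 = 1 - a^2 and s commutes with a.
    [rep_star_inverse], applied to u (x) 1 and its inverse in both orders, gives the swap for u and
    for its adjoint. *)
Lemma rep_iota_swap_lt1 (H : hilbertType R) (rho : X -> {linear H -> H}) a h :
  star_representation rho -> star a = a -> bnorm a < 1 ->
  rho (iota (tens a 1 - tens 1 a)) h = 0.
Proof.
move=> hrho sa a1.
have saa : star (a * a) = a * a by rewrite starM sa.
have aa1 : bnorm (a * a) < 1.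
  rewrite (cstar_norm_sa (bnorm_cstar A)) // expr_lt1 //.
  exact: (bsn_ge0 (bnorm_bsn A)).
have [s [ss s2 sC]] := sa_sqrt (bnorm_bsn A) saa aa1.
have as_comm : a * s = s * a by apply: sC; rewrite mulrA.
pose u := a + 'i *: s; pose u' := a - 'i *: s.
have iconj : conjc 'i = - 'i :> R[i] by simpc.
have su : star u = u' by rewrite /u starD starZ sa ss iconj scaleNr.
have su' : star u' = u by rewrite -su starK.
have norm_sq : a * a + s * s = 1 by rewrite s2 addrC subrK.
have uu' : u * u' = 1.
  rewrite /u /u' mulrDl !mulrBr -!scalerAl -!scalerAr as_comm scalerA.
  by rewrite -['i * 'i]expr2 sqr_i scaleN1r opprK addrA subrK norm_sq.
have u'u : u' * u = 1.
  rewrite /u /u' mulrBl !mulrDr -!scalerAl -!scalerAr as_comm scalerA.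
  by rewrite -['i * 'i]expr2 sqr_i scaleN1r opprD opprK addrA addrK norm_sq.
have A1 : bnorm (1 : A) = 1 := cstar_norm1 (bnorm_cstar A).
have unit_norm (v v' : A) : star v = v' -> v' * v = 1 -> bnorm v = 1.
  move=> <- vv; apply/eqP; rewrite -(@eqrXn2 _ 2) ?(bsn_ge0 (bnorm_bsn A)) //.
  by rewrite -(cstar_identity v) vv A1 expr1n.
have swap (v v' : A) : star v = v' -> star v' = v -> v * v' = 1 -> v' * v = 1 ->
    rho (iota (tens 1 v')) h = rho (iota (tens v' 1)) h.
  move=> vv' v'v e1 e2; rewrite -{1}vv' -{1}star1 -(rpt_star hX).
  apply: (rep_star_inverse hrho).
  - by rewrite (rpt_mul hX) e1 mul1r iota1.
  - by rewrite bnorm_iota (unit_norm v v') // A1 mul1r.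
  - by rewrite bnorm_iota (unit_norm v' v) // A1 mul1r.
have hu' := swap u u' su su' uu' u'u.
have hu := swap u' u su' su u'u uu'.
have aE : a = 2^-1 *: (u + u').
  rewrite /u /u' addrACA subrr addr0 -[a + a]mulr2n -[a *+ 2]scaler_nat scalerA.
  by rewrite mulVf ?scale1r.
rewrite aE tensZl tensZr -scalerBr tensDl tensDr linearZ /= linearB !linearD /=.
rewrite -!scalerDr -opprD (repZ hrho) (repB hrho) !(repD hrho).
by rewrite hu hu' subrr scaler0.
Qed.

Lemma rep_iota_swap (H : hilbertType R) (rho : X -> {linear H -> H}) a h :
  star_representation rho -> star a = a ->
  rho (iota (tens a 1 - tens 1 a)) h = 0.
Proof.
move=> hrho sa; pose t := (bnorm a + 1)^-1.
have t0 : 0 < t by rewrite invr_gt0 ltr_wpDl // (bsn_ge0 (bnorm_bsn A)).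
have := rep_iota_swap_lt1 h hrho (_ : star (t%:C *: a) = t%:C *: a).
rewrite starZR sa (bsnZR (bnorm_bsn A)) gtr0_norm // => /(_ erefl).
rewrite mulrC ltr_pdivrMr ?mul1r ?ltrDl //; last by rewrite -invr_gt0.
move=> /(_ ltr01); rewrite tensZl tensZr -scalerBr linearZ /= (repZ hrho).
by move=> /eqP; rewrite scaler_eq0 eq_complex /= gt_eqF //= => /eqP.
Qed.

End Radical.

(** * The scalar case *)

Section ComplexHilbert.
Context {R : realType}.

(** Real and imaginary parts are 1-Lipschitz, so both coordinates converge by completeness of R. *)
Lemma complex_cauchy_cvg (F : set_system (R[i]^o)) :
  ProperFilter F -> cauchy F -> cvg F.
Proof.
move=> FF /cauchyP Fex.
have coord (p : R[i] -> R) :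
    (forall z w, `|p z - p w| <= Normc.normc (z - w)) -> cvg (p @ F).
  move=> hp; apply: cauchy_cvg; apply: cauchy_exP => e e0.
  have [|z Fz] := Fex e%:C; first by rewrite ltcR.
  exists (p z); apply: (@filterS _ F _ _ _ _ Fz) => w.
  rewrite -!ball_normE /ball_ /= => zw.
  by apply: le_lt_trans (hp _ _) _; rewrite -ltcR; exact: zw.
have /cvg_ex[a ha] : cvg (@complex.Re R @ F).
  apply: coord => -[x y] [x' y'] /=.
  by rewrite -sqrtr_sqr ler_wsqrtr // lerDl sqr_ge0.
have /cvg_ex[b hb] : cvg (@complex.Im R @ F).
  apply: coord => -[x y] [x' y'] /=.
  by rewrite -sqrtr_sqr ler_wsqrtr // lerDr sqr_ge0.
apply/cvg_ex; exists (a +i* b : R[i]^o); apply/cvgrPdist_lt => e.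
rewrite ltcE /= => /andP[/eqP e_im e0].
have e20 : 0 < complex.Re e / 2 by rewrite divr_gt0.
move/cvgrPdist_lt : ha => /(_ _ e20) ha.
move/cvgrPdist_lt : hb => /(_ _ e20) hb.
apply: filterS2 ha hb.
move=> [x y] /= xa yb; rewrite ltcE /= e_im eqxx /=.
apply: le_lt_trans (_ : `|a - x| + `|b - y| < _); last first.
  by rewrite [ltRHS]splitr ltrD.
rewrite -[leRHS]ger0_norm ?addr_ge0 // -sqrtr_sqr ler_wsqrtr //.
rewrite [leRHS]sqrrD !real_normK ?num_real // -addrA lerD2l lerDr.
by rewrite mulrn_wge0 // mulr_ge0.
Qed.

(* The key [GRing.regular] of [R[i]^o] is already taken by the completeness of
   realTypes. *)
Definition complex_line : Type := R[i]^o.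

HB.instance Definition _ := NormedModule.copy complex_line (R[i]^o).
HB.instance Definition _ :=
  Uniform_isComplete.Build complex_line complex_cauchy_cvg.

Definition complex_dot (x y : complex_line) : R[i] := (x : R[i]) * conjc y.

Lemma complex_dot_sesquilinear :
  bilinear_for ( *%R) (conjc \; *%R) complex_dot.
Proof.
split=> [y c x x'|x c y y']; rewrite /complex_dot.
  by rewrite mulrDl -mulrA.
by rewrite rmorphD rmorphM mulrDr mulrCA.
Qed.

HB.instance Definition _ := isBilinear.Build R[i] complex_line complex_line R[i]
  ( *%R) (conjc \; *%R) complex_dot
  (fun y => zmod_morphism_linear (complex_dot_sesquilinear.1 y))
  (fun x => zmod_morphism_linear (complex_dot_sesquilinear.2 x))
  (fun y => scalable_linear (complex_dot_sesquilinear.1 y))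
  (fun x => scalable_linear (complex_dot_sesquilinear.2 x)).

Lemma complex_dotC x y :
  complex_dot x y = (-1) ^+ false * conjc (complex_dot y x).
Proof. by rewrite expr0 mul1r /complex_dot rmorphM /= conjcK mulrC. Qed.

HB.instance Definition _ := isHermitianSesquilinear.Build R[i]
  complex_line false conjc complex_dot complex_dotC.

Lemma complex_dotE (x : complex_line) : complex_dot x x = `|x| ^+ 2.
Proof. by rewrite /complex_dot -sqr_normc. Qed.

Lemma complex_dot_gt0 (x : complex_line) : x != 0 -> 0 < complex_dot x x.
Proof. by move=> x0; rewrite complex_dotE exprn_gt0 // normr_gt0. Qed.

HB.instance Definition _ := isDotProduct.Build R[i] complex_line complex_dot
  complex_dot_gt0.

HB.instance Definition _ := isHilbert.Build R complex_line complex_dotE.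

End ComplexHilbert.

(** * Approximate eigenvectors in the reverse tensor product *)

Lemma tensBl (K : fieldType) (V W : lmodType K) (v v' : V) (w : W) :
  tens (v - v') w = tens v w - tens v' w.
Proof. by rewrite tensDl -scaleN1r tensZl scaleN1r. Qed.

Section ReverseTensor.
Context {R : realType} {A : cstarAlgType R} {N : forall n, 'M[A]_n -> R}
  {X : banachStarAlgType R} {iota : {linear A (x) A -> X}}.
Hypotheses (hN : cstar_matrix_norms N) (hX : rev_proj_tensor N iota).

Local Notation bsn := (bnorm_bsn X).

(* With y and z approximate eigenvectors for 1 and -1,
   (a y) (x) z - y (x) (a z) is close to 2 (y (x) z). *)
Lemma iota_sub_neq0 (a : A) : approx_eigen a 1 -> approx_eigen a (-1) ->
  iota (tens a 1 - tens 1 a) != 0.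
Proof.
move=> h1 hN1; apply/eqP => h0.
(* Each error is less than |y| |z| / 2, so the difference in [yz] has norm less than |y| |z|,
   against the exact value 2 |y| |z|. *)
have e0 : 0 < (2^-1 : R) by rewrite invr_gt0.
have [y hy] := h1 _ e0; have [z hz] := hN1 _ e0.
rewrite rmorph1 scale1r in hy; rewrite rmorphN rmorph1 scaleN1r opprK in hz.
have swap : iota (tens (a * y) z) = iota (tens y (a * z)).
  apply/eqP; rewrite -subr_eq0; apply/eqP.
  have := congr1 (fun x => x * iota (tens y z)) h0.
  by rewrite linearB /= mulrBl !(rpt_mul hX) !mul1r mul0r.
have yz : iota (tens (a * y - y) z) - iota (tens y (a * z + z)) =
    - (2%:C *: iota (tens y z)).
  rewrite tensBl tensDr linearB linearD /= swap opprD addrACA subrr add0r.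
  by rewrite rmorphMn rmorph1 scaler_nat mulr2n opprD.
have := bsnB bsn (iota (tens (a * y - y) z)) (iota (tens y (a * z + z))).
rewrite yz (bsnN bsn) (bsnZR bsn) ger0_norm // !(bnorm_iota hN hX).
have y0 := bsn_ge0 (bnorm_bsn A) y; have z0 := bsn_ge0 (bnorm_bsn A) z.
have y_gt0 : 0 < bnorm y by have := bsn_ge0 (bnorm_bsn A) (a * y - y); lra.
have z_gt0 : 0 < bnorm z by have := bsn_ge0 (bnorm_bsn A) (a * z + z); lra.
have k1 : bnorm (a * y - y) * bnorm z < 2^-1 * bnorm y * bnorm z.
  by rewrite ltr_pM2r.
have k2 : bnorm y * bnorm (a * z + z) < bnorm y * (2^-1 * bnorm z).
  by rewrite ltr_pM2l.
have yz0 := mulr_gt0 y_gt0 z_gt0.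
nra.
Qed.

(* (1 + a (x) a) (y (x) z) = (a y - y) (x) a z + y (x) (a z + z) is small. *)
Lemma not_invertible_approx (a : A) : approx_eigen a 1 -> approx_eigen a (-1) ->
  ~ invertible (1 + iota (tens a a)).
Proof.
move=> h1 hN1 [r [rl _]].
have r0 := bsn_ge0 bsn r.
(* The two error terms add up to at most 3 e |y| |z|, where |a z| <= 2 |z| accounts for 2 e; this e
   makes 3 e |r| less than 1. *)
have e0 : 0 < (4 * (bnorm r + 1))^-1 by rewrite invr_gt0 mulr_gt0 // ltr_wpDl.
set e := _^-1 in e0.
have e_def : e * (4 * (bnorm r + 1)) = 1.
  by rewrite mulVf // mulf_neq0 // gt_eqF // ltr_wpDl.
have [y hy] := h1 _ e0; have [z hz] := hN1 _ e0.
rewrite rmorph1 scale1r in hy; rewrite rmorphN rmorph1 scaleN1r opprK in hz.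
have yz : iota (tens y z) =
    r * (iota (tens (a * y - y) (a * z)) + iota (tens y (a * z + z))).
  rewrite -[LHS]mul1r -rl -mulrA mulrDl mul1r (rpt_mul hX); congr (r * _).
  rewrite tensBl tensDr linearB linearD /= addrA subrK addrC //.
have y0 := bsn_ge0 (bnorm_bsn A) y; have z0 := bsn_ge0 (bnorm_bsn A) z.
have y_gt0 : 0 < bnorm y by have := bsn_ge0 (bnorm_bsn A) (a * y - y); nra.
have z_gt0 : 0 < bnorm z by have := bsn_ge0 (bnorm_bsn A) (a * z + z); nra.
have := congr1 bnorm yz; rewrite (bnorm_iota hN hX) => yzE.
have := bnormM r (iota (tens (a * y - y) (a * z)) + iota (tens y (a * z + z))).
rewrite -yzE.
have := bnormD (iota (tens (a * y - y) (a * z))) (iota (tens y (a * z + z))).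
rewrite !(bnorm_iota hN hX).
have az : bnorm (a * z) <= 2 * bnorm z.
  have := bsnB (bnorm_bsn A) (a * z + z) z; rewrite addrK.
  have e1 : e <= 1 by nra.
  nra.
have yz0 := mulr_gt0 y_gt0 z_gt0.
have k1 : bnorm (a * y - y) * bnorm (a * z) <= e * bnorm y * (2 * bnorm z).
  by rewrite ler_pM // ?(bsn_ge0 (bnorm_bsn A)) // ltW.
have k2 : bnorm y * bnorm (a * z + z) <= bnorm y * (e * bnorm z).
  by rewrite ler_wpM2l // ltW.
set s := bnorm (_ + _) => s1 s2.
have s3 : s <= 3 * e * (bnorm y * bnorm z).
  by apply: le_trans s1 _; lra.
have := ler_wpM2l r0 s3; nra.
Qed.

(** The range of [iota] consists of scalars; the coefficients [c n] of scalars approximating x form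
    a Cauchy sequence, and their limit is the coefficient of x. *)
Lemma scalar_completion : (forall a : A, exists c : R[i], a = c%:A) ->
  forall x : X, exists c : R[i], x = c%:A.
Proof.
move=> hA x.
have scal u : exists c : R[i], iota u = c%:A.
  rewrite [u]tensor_sum linear_sum.
  elim: (repr u) => [|[a b] s [c hc]].
    by exists 0; rewrite big_nil scale0r.
  rewrite big_cons hc; have [d ->] := hA a; have [f ->] := hA b.
  exists (d * f + c); rewrite tensZl tensZr !linearZ /= (iota1 hX).
  by rewrite scalerDl scalerA.
have /choice[c hc] (n : nat) : exists c : R[i], bnorm (x - c%:A) < n.+1%:R^-1.
  have [|u hu] := rpt_dense hX x (_ : 0 < n.+1%:R^-1).
    by rewrite invr_gt0.
  by have [d hd] := scal u; exists d; rewrite -hd.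
have b1 : 0 < bnorm (1 : X).
  rewrite lt_neqAle (bsn_ge0 bsn) andbT eq_sym; apply/eqP => /(bsn_eq0 bsn).
  by apply/eqP; exact: oner_neq0.
have small e : 0 < e -> exists m : nat, m.+1%:R^-1 < e :> R.
  move=> e0; exists (Num.trunc e^-1).
  by rewrite invf_plt ?posrE // truncnS_gt.
have inv_le (m n : nat) : (m <= n)%N -> n.+1%:R^-1 <= m.+1%:R^-1 :> R.
  by move=> mn; rewrite lef_pV2 ?posrE // ler_nat.
have dist n m :
    Normc.normc (c n - c m) * bnorm (1 : X) <= n.+1%:R^-1 + m.+1%:R^-1.
  rewrite -bnormZ scalerBl (le_trans (bsn_tri bsn x _ _)) // ltW // ltrD //.
  by rewrite (bsnC bsn).
pose cc (n : nat) : R[i]^o := c n.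
have /complex_cauchy_cvg : cauchy (cc @ \oo).
  apply: cauchy_exP => e; rewrite ltcE /= => /andP[/eqP e_im e0].
  have [|m hm] := small (complex.Re e * bnorm (1 : X) / 2).
    by rewrite divr_gt0 ?mulr_gt0.
  exists (c m); exists m => // n /= mn.
  rewrite -ball_normE /ball_ /= ltcE /= e_im eqxx /=.
  rewrite -(ltr_pM2r b1); have := dist m n; have := inv_le _ _ mn.
  case: (c m - c n) => p q /= nm /le_lt_trans; apply.
  apply: (@le_lt_trans _ _ (m.+1%:R^-1 + m.+1%:R^-1)); first by rewrite lerD2l.
  by rewrite [ltRHS]splitr ltrD.
move=> /cvg_ex[l /cvgrPdist_lt hl].
exists l; apply/eqP; rewrite -subr_eq0; apply/eqP.
apply: (@bsn_small _ _ _ bsn _ (1 + bnorm (1 : X))) => e e0.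
have [|m _ hm] := hl e%:C; first by rewrite ltcR.
have [n hn] := small e e0.
have := bsn_tri bsn (c (maxn m n))%:A x l%:A; rewrite -scalerBl bnormZ.
have := hc (maxn m n); have := inv_le _ _ (leq_maxr m n).
have := hm (maxn m n) (leq_maxl m n); rewrite /cc /= ltcE /= => /andP[_].
rewrite -(normcN (l - _)) opprB.
case: (c _ - l) => p q /= h1 h2 h3; move=> /le_trans; apply.
rewrite mulrDl mul1r [bnorm 1 * e]mulrC lerD // ?ler_pM2r ?ltW //.
exact: lt_trans h3 (le_lt_trans h2 hn).
Qed.

End ReverseTensor.

(** * Semisimplicity and symmetry of the scalar algebra *)

Section ScalarRepresentation.
Context {R : realType}.

Definition line_scale (c : R[i]) (h : @complex_line R) : @complex_line R :=
  c *: h.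

Lemma line_scale_linear c : linear (line_scale c).
Proof.
by move=> d h k; rewrite /line_scale scalerDr !scalerA mulrC.
Qed.

HB.instance Definition _ c := GRing.isLinear.Build R[i] complex_line
  complex_line *:%R (line_scale c) (line_scale_linear c).

(** The coefficient of 1 defines a faithful *-representation on the one-dimensional Hilbert
    space. *)
Lemma scalar_semisimple (X : banachStarAlgType R) :
  (forall x : X, exists c : R[i], x = c%:A) -> star_semisimple X.
Proof.
move=> /choice[k kE].
have kI (c d : R[i]) : c%:A = d%:A :> X -> c = d.
  move=> /eqP; rewrite -subr_eq0 -scalerBl scaler_eq0 (oner_eq0 X) orbF.
  by rewrite subr_eq0 => /eqP.
pose rho (x : X) : {linear complex_line -> complex_line} := line_scale (k x).
have hrho : star_representation rho.
  split.
  - by move=> x h; exact: scaler_continuous.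
  - move=> x y h; rewrite /rho /= /line_scale -scalerDl; congr (_ *: _).
    by apply: kI; rewrite scalerDl -!kE.
  - move=> c x h; rewrite /rho /= /line_scale scalerA; congr (_ *: _).
    by apply: kI; rewrite -scalerA -!kE.
  - move=> x y h; rewrite /rho /= /line_scale scalerA; congr (_ *: _).
    by apply: kI; rewrite -kE {1}[x]kE -scalerAl mul1r {1}[y]kE scalerA.
  - move=> x h l.
    have ks : k (star x) = conjc (k x).
      by apply: kI; rewrite -kE {1}[x]kE starZ star1.
    change ((k x * h) * conjc l = h * conjc (k (star x) * l)).
    by rewrite ks rmorphM /= conjcK mulrCA mulrA.
apply/seteqP; split=> x.
  move=> /(_ _ _ hrho (1 : R[i])) /= h.
  have kx : k x = 0 by rewrite -[k x]mulr1.
  by rewrite /= [x]kE kx scale0r.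
move=> -> H tau htau h.
by have := repZ htau 0 0 h; rewrite !scale0r.
Qed.

Lemma scalar_symmetric (X : banachStarAlgType R) :
  (forall x : X, exists c : R[i], x = c%:A) -> star_symmetric X.
Proof.
move=> hX x; have [c ->] := hX x.
have -> : 1 + star c%:A * c%:A = (1 + c * conjc c)%:A :> X.
  by rewrite starZ star1 -scalerAl mul1r scalerA scalerDl scale1r mulrC.
have c0 : 1 + c * conjc c != 0.
  by rewrite gt_eqF // ltr_wpDr // mulcJ_ge0.
exists (1 + c * conjc c)^-1%:A.
by rewrite -!scalerAl !mul1r !scalerA mulVf // mulfV // scale1r.
Qed.

End ScalarRepresentation.

Theorem corollary3p2 (R : realType) (A : cstarAlgType R)
    (N : forall n, 'M[A]_n -> R) (hN : cstar_matrix_norms N)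
    (X : banachStarAlgType R) (iota : {linear A (x) A -> X})
    (hX : rev_proj_tensor N iota) :
  (star_semisimple X <-> forall a : A, exists c : R[i], a = c%:A) /\
  (star_symmetric X <-> forall a : A, exists c : R[i], a = c%:A).
Proof.
split; split=> [hs|/(scalar_completion hX)]; last 1 first.
- exact: scalar_symmetric.
- apply: contrapT => /approx_eigen_pm1[a [sa a1 aN1]].
  have /eqP := iota_sub_neq0 hN hX a1 aN1; apply.
  suff : @star_radical R X (iota (tens a 1 - tens 1 a)) by rewrite hs.
  by move=> H rho hrho h; exact: rep_iota_swap.
- exact: scalar_semisimple.
- apply: contrapT => /approx_eigen_pm1[a [sa a1 aN1]].
  apply: (not_invertible_approx hN hX a1 aN1).
  have := hs (iota (tens a 1)).
  by rewrite (rpt_star hX) sa star1 (rpt_mul hX) mul1r mulr1.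
Qed.
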